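(* There exists an absolute constant $C>0$ such that the following holds. For any subset $A$ of $[n]$ of size $m\ge C\sqrt n$, there exists an integer $d\ge1$ such that, for $A'=\{x/d: x\in A,\ d\mid x\}$ and $k=2^{50}n/m$, the set $\Sigma^{[k]}(A')$ contains an interval of integers of length at least $n$. Furthermore, \[|A|-|A'|\le 2^{30}(\log n)^3+\frac{2^{30}n}{m}.\]
   Context: $[n]=\{1,\dots,n\}$, $\log$ is the natural logarithm, and for a set $A$ of integers, $\Sigma^{[h]}(A)=\{\sum_{s\in S}s: S\subseteq A,\ |S|\le h\}$. *)

(* Defs.v *)
From mathcomp Require Import all_boot.
From Stdlib Require Import Reals.

Set Implicit Arguments.
Unset Strict Implicit.
Unset Printing Implicit Defensive.

(* A subset of [n] = {1,...,n} is encoded as A : {set 'I_n.+1} with 0 \notin A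
   (elements are read through the coercion 'I_n.+1 >-> nat). *)
Definition subset_of_range (n : nat) (A : {set 'I_n.+1}) : Prop :=
  forall x : 'I_n.+1, x \in A -> (0 < x)%N.

(* A' = { x / d : x in A, d | x }.  Since x/d <= x <= n, A' again lives in 'I_n.+1. *)
Definition div_set (n d : nat) (A : {set 'I_n.+1}) : {set 'I_n.+1} :=
  [set i : 'I_n.+1 | [exists x in A, (d %| x) && (x %/ d == i :> nat)]].

(* s \in Sigma^{[h]}(A) : s is the sum of the elements of some S \subseteq A with |S| <= h
   (h real, since k = 2^50 n / m need not be an integer). *)
Definition in_subset_sums (N : nat) (h : R) (A : {set 'I_N}) (s : nat) : Prop :=
  exists S : {set 'I_N}, S \subset A /\ (INR #|S| <= h)%R /\ (\sum_(x in S) (x : nat))%N = s.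

(* Main.v *)
(** * Long intervals in sets of subset sums

Adding an element [x] to the pool of summands replaces a set [S] of subset sums
by [S + {0, x}], which is larger by [lam S x], the number of elements of [S]
leaving [S] under the shift by [x].  As a function of [x], [lam S] is even and
subadditive, and its average over a set [Y] of shifts is at least
[|S| - |S|^2/|Y|].  Let [N0] be the largest element of the pool [Q].  If [Q]
has no common divisor, the balls of the Cayley graph of [Z/N0] generated by [Q]
grow linearly with rate [|Q|/3], so the integers that are signed sums of at most
[i] elements of [Q] grow like [i^2 |Q|] until they fill intervals.  Hence some
[x] in [Q] has [lam S x] of order [sqrt (|S| |Q|)], and at least [10/11 N0] as
soon as [S] is much larger than [N0^2/|Q|].  After [O(N0/|Q|)] well chosen
steps, [S] occupies more than half of its range; two such sets built from
disjoint elements sum to an interval of length [N0], which further elements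
extend.

What makes the argument run is robustness: removing the elements already used
must neither create a common divisor nor halve the largest element.  Both are
arranged by extremal choices with thresholds that increase geometrically: [d] is
the largest divisor with few non-multiples in [A], and [N] the least bound
exceeded by few elements of [A/d].  When [n/m < log n] the budget is too small
to start from [S = {0}], and one starts from a block of [m/4] elements instead. *)

Require Import Defs.
From mathcomp Require Import all_boot all_order all_algebra.
From mathcomp Require Import zify.

Set Implicit Arguments.
Unset Strict Implicit.
Unset Printing Implicit Defensive.

Import Order.TTheory GRing.Theory Num.Theory.

Local Open Scope ring_scope.

(** * Shifts of finite sets of integers *)

Definition lam (S : seq int) (y : int) : nat := count (fun z : int => z + y \notin S) S.

Lemma lam_mem (S : seq int) (y : int) :
  (count (fun z : int => (z + y)%R \in S) S + lam S y = size S)%N.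
Proof. by rewrite /lam -(count_predC (fun z : int => z + y \in S)). Qed.

Lemma uniq_count_shift (S : seq int) (p : pred int) (y : int) : uniq S ->
  (count (fun z : int => ((z + y)%R \in S) && p (z + y)%R) S <= count p S)%N.
Proof.
move=> uS; rewrite -!size_filter -(size_map (fun z : int => z + y)).
apply: uniq_leq_size.
  by rewrite map_inj_uniq ?filter_uniq // => u v /addIr.
by move=> w /mapP[z]; rewrite !mem_filter => /andP[/andP[h1 h2] _] ->; rewrite h1 h2.
Qed.

(** If [z + y + y'] is outside [S], then either [z] leaves [S] under [y], or [z + y] is an element
    of [S] that leaves under [y']. Injectivity of translation bounds the second kind by
    [lam S y']. *)
Lemma lamD (S : seq int) (y y' : int) : uniq S -> (lam S (y + y')%R <= lam S y + lam S y')%N.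
Proof.
move=> uS; have := @uniq_count_shift S (fun z : int => z + y' \notin S) y uS.
rewrite -/(lam S y') => h; apply: leq_trans (leq_add (leqnn _) h).
rewrite /lam -count_predUI.
apply: leq_trans (leq_addr _ _); apply: sub_count => z /=; rewrite addrA => ->.
by rewrite andbT orNb.
Qed.

Lemma lamN (S : seq int) (y : int) : uniq S -> (lam S (- y)%R <= lam S y)%N.
Proof.
move=> uS; have := @uniq_count_shift S (fun z : int => z - y \in S) y uS.
have := lam_mem S y; have := lam_mem S (- y).
have -> : count (fun z : int => (z + y \in S) && (z + y - y \in S)) S
        = count (fun z : int => (z + y)%R \in S) S.
  by apply: eq_in_count => z zS /=; rewrite addrK zS andbT.
lia.
Qed.

Lemma lam0 (S : seq int) : lam S 0 = 0%N.
Proof.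
by rewrite /lam; apply/eqP; rewrite -leqn0 leqNgt -has_count; apply/hasPn => z zS; rewrite addr0 zS.
Qed.

Lemma lam_mulrn (S : seq int) (y : int) t : uniq S -> (lam S (y *+ t)%R <= t * lam S y)%N.
Proof.
move=> uS; elim: t => [|t IH]; first by rewrite mulr0n lam0.
by rewrite mulrS mulSn (leq_trans (lamD _ _ uS)) ?leq_add2l.
Qed.

Lemma lam_mulrz (S : seq int) (y : int) (t : int) : uniq S -> (lam S (y * t)%R <= `|t| * lam S y)%N.
Proof.
move=> uS; case: t => t.
  by rewrite absz_nat -[Posz t]natz mulr_natr lam_mulrn.
rewrite NegzE mulrN (leq_trans (lamN _ uS)) // abszN absz_nat.
by rewrite -[Posz _]natz mulr_natr lam_mulrn.
Qed.

(** Double counting of the pairs with [z + y] in [S]: for each [z] the admissible [y] inject into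
    [S], so there are at most [size S] of them. *)
Lemma lam_avg (S Y : seq int) : uniq S -> uniq Y ->
  (size Y * size S <= size S * size S + \sum_(y <- Y) lam S y)%N.
Proof.
move=> uS uY.
have -> : (size Y * size S = \sum_(y <- Y) (count (fun z : int => (z + y)%R \in S) S + lam S y))%N.
  rewrite (eq_bigr (fun=> size S)) ?big_const_seq ?count_predT ?iter_addn_0 1?mulnC //.
  by move=> y _; exact: lam_mem.
rewrite big_split /= leq_add2r.
have -> : (\sum_(y <- Y) count (fun z : int => (z + y)%R \in S) S
     = \sum_(z <- S) count (fun y : int => (z + y)%R \in S) Y)%N.
  under eq_bigr => y _ do rewrite -sum1_count big_mkcond.
  rewrite exchange_big /=; apply: eq_bigr => z _.
  by rewrite -sum1_count [RHS]big_mkcond.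
apply: (@leq_trans (\sum_(z <- S) size S)%N); last first.
  by rewrite big_const_seq count_predT iter_addn_0.
apply: leq_sum => z _; rewrite -size_filter -(size_map (fun y : int => z + y)).
apply: uniq_leq_size; first by rewrite map_inj_uniq ?filter_uniq // => u v /addrI.
by move=> w /mapP[y]; rewrite mem_filter => /andP[h _] ->.
Qed.

(** The union of [S] and [S + x], listed without repetition so that the gain in size is exactly
    [lam S x]. *)
Definition grow (S : seq int) (x : int) : seq int :=
  S ++ [seq z + x | z <- S & z + x \notin S].

Lemma size_grow S x : size (grow S x) = (size S + lam S x)%N.
Proof. by rewrite size_cat size_map size_filter. Qed.

Lemma uniq_grow S x : uniq S -> uniq (grow S x).
Proof.
move=> uS; rewrite cat_uniq uS /=; apply/andP; split.
  by apply/hasPn => w /mapP[z]; rewrite mem_filter => /andP[h _] ->.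
by rewrite map_inj_uniq ?filter_uniq // => u v /addIr.
Qed.

Lemma mem_grow S x w : w \in grow S x -> w \in S \/ exists2 z, z \in S & w = z + x.
Proof.
rewrite mem_cat => /orP[|/mapP[z]]; first by left.
by rewrite mem_filter => /andP[_ zS] ->; right; exists z.
Qed.

(** * Balls in Cayley graphs *)

Fixpoint ball (G : finZmodType) (X : {set G}) (j : nat) : {set G} :=
  if j is i.+1 then [set v + x | v in ball X i, x in X] else [set 0].

(** A point [v] at distance exactly [j + 2] from 0 has its whole neighbourhood [v + X] outside the
    ball of radius [j] and inside that of radius [j + 3]. Every three steps therefore add [#|X|]
    points, until the ball is the group. *)
Lemma card_ball (G : finZmodType) (X : {set G}) :
  0 \in X -> (forall x, x \in X -> - x \in X) ->
  (forall V : {set G}, 0 \in V ->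
     (forall v x, v \in V -> x \in X -> v + x \in V) -> V = setT) ->
  forall i, (minn #|G| (i * #|X|) <= #|ball X (3 * i)|)%N.
Proof.
move=> X0 XN gen.
have sub j : ball X j \subset ball X j.+1.
  by apply/subsetP => v vB; apply/imset2P; exists v 0; rewrite ?addr0.
have b0 j : 0 \in ball X j by elim: j => [|j IH]; [rewrite inE | apply: (subsetP (sub j))].
elim=> [|i IH]; first by rewrite mul0n minn0.
rewrite mulnS addnC addn3; set j := (3 * i)%N in IH *.
have [E|E] := eqVneq (ball X j.+2) setT.
  have -> : ball X j.+3 = setT by apply/eqP; rewrite eqEsubset subsetT -E sub.
  by rewrite cardsT geq_minl.
have [v vB vN] : exists2 v, v \in ball X j.+2 & v \notin ball X j.+1.
  apply/subsetPn; apply: contraNN E => /subsetP ss.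
  have E' : ball X j.+1 = setT by apply: gen => // v x vV xX; apply: ss; apply/imset2P; exists v x.
  by rewrite eqEsubset subsetT -E' sub.
(* [v + X] misses [ball X j]: otherwise [v] would lie in [ball X j.+1] by symmetry of [X]. *)
have dis : [disjoint ball X j & [set v + x | x in X]].
  apply/pred0P => w /=; apply/negP => /andP[wB /imsetP[x xX Ew]]; case/negP: vN.
  by apply/imset2P; exists w (- x) => //; [exact: XN | rewrite Ew addrK].
have ss : ball X j :|: [set v + x | x in X] \subset ball X j.+3.
  rewrite subUset; apply/andP; split.
    exact: subset_trans (sub _) (subset_trans (sub _) (sub _)).
  by apply/subsetP => w /imsetP[x xX ->]; apply/imset2P; exists v x.
have := subset_leq_card ss; rewrite cardsU disjoint_setI0 // cards0 subn0.
rewrite card_imset; last by move=> u w /addrI.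
move: IH; rewrite mulSn; move: #|G| #|X| (i * _)%N #|ball X j| #|ball X j.+3| => a b c e f; lia.
Qed.

(** The integers [k] whose translation preserves [V] are closed under addition and, since [N0] acts
    as 0, under subtraction. The least positive one divides every element of [Q], hence is 1. *)
Lemma Zp_stable_setT n N0 (Q : {set 'I_n.+1}) (V : {set 'Z_N0}) : (1 < N0)%N ->
  (forall q, (1 < q)%N -> exists2 x, x \in Q & ~~ (q %| x)%N) ->
  0 \in V -> (forall v x, v \in V -> x \in Q -> v + (x : nat)%:R \in V) -> V = setT.
Proof.
move=> N1 gcdQ V0 VQ.
have N00 : N0%:R = 0 :> 'Z_N0 by exact: pchar_Zp.
pose K k := [forall v in V, v + k%:R \in V].
have KP k : reflect (forall v, v \in V -> v + k%:R \in V) (K k) by apply: forall_inP.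
have KD a b : K a -> K b -> K (a + b)%N.
  by move=> /KP Ka /KP Kb; apply/KP => v vV; rewrite natrD addrA Kb ?Ka.
have KM a j : K a -> K (j * a)%N.
  move=> Ka; elim: j => [|j IH]; last by rewrite mulSn KD.
  by rewrite mul0n; apply/KP => v; rewrite addr0.
have KB a b : K a -> K (a + b)%N -> K b.
  move=> Ka Kab; have /KP := KD _ _ (KM _ N0.-1 Ka) Kab.
  rewrite addnA -mulSnr prednK; last lia.
  by rewrite natrD natrM N00 mul0r add0r => h; apply/KP.
have exK : exists k, (0 < k)%N && K k.
  exists N0; rewrite (ltnW N1) /=; apply/KP => v vV; by rewrite N00 addr0.
case: (ex_minnP exK) => q /andP[q0 Kq] qmin.
have q1 : (q <= 1)%N.
  rewrite leqNgt; apply/negP => /gcdQ[x xQ /negP]; apply.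
  have Kx : K x by apply/KP => v vV; apply: VQ.
  rewrite /dvdn; apply/negPn/negP; rewrite -lt0n => r0.
  have Kr : K (x %% q)%N by apply: (KB (x %/ q * q)%N); [exact: KM | rewrite -divn_eq].
  have := qmin (x %% q)%N; rewrite r0 Kr => /(_ isT).
  by rewrite leqNgt ltn_pmod.
have {q q0 Kq qmin q1} K1 : K 1%N by have <- : q = 1%N by lia.
apply/setP => r; rewrite inE -[r]natr_Zp -[_%:R]add0r.
by have /KP := KM _ (r : nat) K1; rewrite muln1; apply.
Qed.

(** A residue in the ball of radius [3 i] lifts to a signed sum of at most [3 i] elements of [Q];
    subadditivity and evenness of [lam S] bound the cost of the lift. *)
Lemma reachable_residues n N0 b (Q : {set 'I_n.+1}) (S : seq int) i : (1 < N0)%N -> uniq S ->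
  (forall x, x \in Q -> (0 < x <= N0)%N) ->
  (forall x, x \in Q -> (lam S (x : nat)%:Z <= b)%N) ->
  (forall q, (1 < q)%N -> exists2 x, x \in Q & ~~ (q %| x)%N) ->
  exists (B : {set 'Z_N0}) (g : 'Z_N0 -> int), (minn N0 (i * #|Q|) <= #|B|)%N /\
    forall r, r \in B ->
      [/\ (g r)%:~R = r, (absz (g r) <= 3 * i * N0)%N & (lam S (g r) <= 3 * i * b)%N].
Proof.
move=> N1 uS QN Qb gcdQ.
pose f (x : 'I_n.+1) : 'Z_N0 := (x : nat)%:R.
pose X : {set 'Z_N0} := 0 |: (f @: Q :|: [set - f x | x in Q]).
have X0 : 0 \in X by rewrite !inE eqxx.
have XN x : x \in X -> - x \in X.
  rewrite !inE oppr_eq0 => /or3P[->//|/imsetP[y yQ ->]|/imsetP[y yQ ->]].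
    by rewrite (imset_f (fun x => - f x)) ?orbT.
  by rewrite opprK imset_f ?orbT.
have gen (V : {set 'Z_N0}) : 0 \in V ->
     (forall v x, v \in V -> x \in X -> v + x \in V) -> V = setT.
  move=> V0 VX; apply: (Zp_stable_setT N1 gcdQ V0) => v x vV xQ.
  by apply: VX => //; rewrite !inE (imset_f f) ?orbT.
have cX : (#|Q| <= #|X|)%N.
  (* Reduction is injective on [Q]: only [N0] itself goes to 0, and smaller elements are their own
     residues. *)
  have <- : #|f @: Q| = #|Q|.
    apply: card_in_imset => x y xQ yQ /(congr1 (@nat_of_ord _)).
    rewrite /f !val_Zp_nat // => e; apply/val_inj => /=.
    have := QN _ xQ; have := QN _ yQ; move: e.
    have [->|?] := eqVneq (x : nat) N0; have [->|?] := eqVneq (y : nat) N0 => //.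
    - rewrite modnn => e h _; rewrite modn_small in e; lia.
    - rewrite modnn => e _ h; rewrite modn_small in e; lia.
    - by move=> e h1 h2; rewrite !modn_small in e => //; lia.
  by apply: subset_leq_card; rewrite /X setUA setUAC subsetUr.
have reachX x : x \in X -> exists u : int,
    [/\ u%:~R = x, (absz u <= N0)%N & (lam S u <= b)%N].
  rewrite !inE => /or3P[/eqP->|/imsetP[y yQ ->]|/imsetP[y yQ ->]].
  - by exists 0; rewrite lam0.
  - by exists (Posz y); rewrite absz_nat Qb //; split=> //; case/andP: (QN _ yQ).
  - exists (- Posz y); rewrite abszN absz_nat (leq_trans (lamN _ uS)) ?Qb //.
    by split=> //; [rewrite rmorphN | case/andP: (QN _ yQ)].
have reachB j r : r \in ball X j -> exists u : int,
    [/\ u%:~R = r, (absz u <= j * N0)%N & (lam S u <= j * b)%N].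
  elim: j r => [|j IH] r.
    by rewrite inE => /eqP->; exists 0; rewrite lam0.
  case/imset2P => v x /IH[u [<- h1 h2]] /reachX[w [<- h3 h4]] ->.
  exists (u + w); split; first by rewrite rmorphD.
    by rewrite mulSn; lia.
  by rewrite mulSn addnC (leq_trans (lamD _ _ uS)) ?leq_add.
have [g gP] : exists g : 'Z_N0 -> int, forall r, r \in ball X (3 * i) ->
    [/\ (g r)%:~R = r, (absz (g r) <= 3 * i * N0)%N & (lam S (g r) <= 3 * i * b)%N].
  apply: (@fin_all_exists _ (fun=> int) (fun r u => r \in ball X (3 * i) ->
    [/\ u%:~R = r, (absz u <= 3 * i * N0)%N & (lam S u <= 3 * i * b)%N])) => r.
  case: (boolP (r \in ball X (3 * i))) => [/reachB[u h]|h].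
    by exists u.
  by exists 0.
exists (ball X (3 * i)), g; split=> //.
have cZ : #|'Z_N0| = N0 by rewrite card_ord Zp_cast.
apply: leq_trans (card_ball X0 XN gen i); rewrite cZ.
by rewrite leq_min !geq_min leqnn /= leq_mul2l cX !orbT.
Qed.

Lemma intr_Zp_eq0 N0 (z : int) : (1 < N0)%N -> z%:~R = 0 :> 'Z_N0 ->
  exists t : int, z = N0%:Z * t.
Proof.
move=> N1; have natP k : k%:R = 0 :> 'Z_N0 -> exists t : int, k%:Z = N0%:Z * t.
  move/(congr1 (@nat_of_ord _)); rewrite val_Zp_nat // => /eqP /dvdnP[t ->].
  by exists t%:Z; rewrite PoszM mulrC.
case: z => k; first exact: natP.
rewrite NegzE rmorphN => /eqP; rewrite oppr_eq0 => /eqP /natP[t ->].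
by exists (- t); rewrite mulrN.
Qed.

(** * Lower bounds for the best gain *)

Lemma leq_sum_size (T : eqType) (Y : seq T) (F : T -> nat) c :
  (forall y, y \in Y -> (F y <= c)%N) -> (\sum_(y <- Y) F y <= size Y * c)%N.
Proof.
move=> h; apply: (@leq_trans (\sum_(y <- Y) c)); last first.
  by rewrite big_const_seq count_predT iter_addn_0 mulnC.
by rewrite big_seq [X in (_ <= X)%N]big_seq; apply: leq_sum.
Qed.

Lemma lam_half (S Y : seq int) c : uniq S -> uniq Y -> (2 * size S <= size Y)%N ->
  (forall y, y \in Y -> (lam S y <= c)%N) -> (size S <= 2 * c)%N.
Proof.
move=> uS uY hY /leq_sum_size h; have := leq_trans (lam_avg uS uY) (leq_add (leqnn _) h).
move: (size S) (size Y) hY => s y hY {}h.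
have h1 : (2 * (s * s) <= y * s)%N by rewrite mulnA leq_mul2r hY orbT.
have [y0|y0] := posnP y; first lia.
rewrite -(leq_pmul2l y0); lia.
Qed.

(** Adding [t N0] with [t < i] to the lifts of the residues gives about [i] times as many distinct
    shifts. Each costs at most [3 i b + i b], and [lam_half] applies to them. *)
Lemma quadratic_growth n N0 b (Q : {set 'I_n.+1}) (S : seq int) (x0 : 'I_n.+1) i :
  x0 \in Q -> x0 = N0 :> nat -> (1 < N0)%N -> uniq S ->
  (forall x, x \in Q -> (0 < x <= N0)%N) ->
  (forall x, x \in Q -> (lam S (x : nat)%:Z <= b)%N) ->
  (forall q, (1 < q)%N -> exists2 x, x \in Q & ~~ (q %| x)%N) ->
  (2 * size S <= i * minn N0 (i * #|Q|))%N -> (size S <= 8 * i * b)%N.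
Proof.
move=> x0Q x0E N1 uS QN Qb gcdQ hS.
have [B [g [cB gP]]] := reachable_residues i N1 uS QN Qb gcdQ.
pose Y := [seq g r + N0%:Z * (t : nat)%:Z | r <- enum B, t <- iota 0 i].
have uY : uniq Y.
  apply: allpairs_uniq; rewrite ?enum_uniq ?iota_uniq //.
  move=> [r t] [r' t'] /allpairsP[[? ?] /= [h1 _ [e1 _]]] /allpairsP[[? ?] /= [h2 _ [e2 _]]] /= e.
  move: h1 h2; rewrite -e1 -e2 !mem_enum => /gP[g1 _ _] /gP[g2 _ _].
  have er : r = r'.
    move/(congr1 (fun z : int => z%:~R : 'Z_N0)): e; rewrite !rmorphD !rmorphM /= g1 g2.
    by rewrite -[(Posz N0)%:~R]/(N0%:R) pchar_Zp // !mul0r !addr0.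
  move: e; rewrite er => /addrI /mulfI; rewrite -lt0n (ltnW N1) => /(_ isT) [->]; done.
have sY : size Y = (#|B| * i)%N by rewrite size_allpairs size_iota -cardE.
have lY y : y \in Y -> (lam S y <= 4 * i * b)%N.
  case/allpairsP => [[r t] /= []]; rewrite mem_enum mem_iota /= add0n => /gP[_ _ h] ht ->.
  apply: leq_trans (lamD _ _ uS) _.
  have h2 := lam_mulrz N0%:Z t%:Z uS; rewrite absz_nat in h2.
  have h3 := Qb _ x0Q; rewrite x0E in h3.
  have h4 : (t * lam S N0%:Z <= i * b)%N by rewrite leq_mul // ltnW.
  lia.
have h2 : (2 * size S <= size Y)%N.
  by rewrite sY (leq_trans hS) // mulnC leq_mul2r cB orbT.
by have := lam_half uS uY h2 lY; rewrite !mulnA.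
Qed.

Lemma pool_growth n (Q : {set 'I_n.+1}) (S : seq int) b :
  uniq S -> (forall x, x \in Q -> (lam S (x : nat)%:Z <= b)%N) ->
  (2 * size S <= #|Q|)%N -> (size S <= 2 * b)%N.
Proof.
move=> uS Qb hQ.
pose Y := [seq (x : nat)%:Z | x : 'I_n.+1 in Q].
have uY : uniq Y by rewrite map_inj_uniq ?enum_uniq // => x y [/val_inj].
have sY : size Y = #|Q| by rewrite size_map -cardE.
apply: (lam_half uS uY); rewrite ?sY // => y /mapP[x]; rewrite mem_enum => xQ ->; exact: Qb.
Qed.

Lemma sum_absz_sym s : (\sum_(k <- iota 0 s.*2.+1) absz (k%:Z - s%:Z) = s * s.+1)%N.
Proof.
have -> : iota 0 s.*2.+1 = index_iota 0 s.*2.+1 by rewrite /index_iota subn0.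
rewrite (@big_cat_nat _ _ _ s) /=; [|done|lia].
rewrite big_nat_rev /= -[X in index_iota X s.*2.+1]add0n big_addn.
have -> : (s.*2.+1 - s = s.+1)%N by lia.
rewrite [X in (_ + X)%N](eq_big_nat _ _ (F2 := id)); last by move=> k _; lia.
rewrite (eq_big_nat _ _ (F2 := fun k => k.+1)); last by move=> k h; lia.
elim: s => [|s IH]; first by rewrite !big_nat1 big_nil.
by rewrite big_nat_recr //= [X in (_ + X)%N]big_nat_recr //= ; lia.
Qed.

(** Now all residues are reached, so every integer [y] is a cheap lift plus a multiple of [N0], and
    costs about [|y| b / N0]. Averaging over [|y| <= size S] forces [b] to be nearly [N0]. *)
Lemma dense_growth n N0 b (Q : {set 'I_n.+1}) (S : seq int) (x0 : 'I_n.+1) i :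
  x0 \in Q -> x0 = N0 :> nat -> (1 < N0)%N -> uniq S ->
  (forall x, x \in Q -> (0 < x <= N0)%N) ->
  (forall x, x \in Q -> (lam S (x : nat)%:Z <= b)%N) ->
  (forall q, (1 < q)%N -> exists2 x, x \in Q & ~~ (q %| x)%N) ->
  (N0 <= i * #|Q|)%N -> (120 * i * N0 <= size S)%N -> (10 * N0 <= 11 * b)%N.
Proof.
move=> x0Q x0E N1 uS QN Qb gcdQ hi hS.
have [B [g [cB gP]]] := reachable_residues i N1 uS QN Qb gcdQ.
have BT : B = setT.
  have cZ : #|'Z_N0| = N0 by rewrite card_ord Zp_cast.
  apply/eqP; rewrite eqEcard subsetT cardsT cZ.
  by rewrite (leq_trans _ cB) // leq_min leqnn.
have lamy (y : int) : (N0 * lam S y <= (absz y + 6 * i * N0) * b)%N.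
  have [|e h1 h2] := gP (y%:~R); first by rewrite BT inE.
  move: e h1 h2; set w := g _ => e h1 h2.
  have [t ht] : exists t : int, y - w = N0%:Z * t.
    by apply: (intr_Zp_eq0 N1); rewrite rmorphB /= e subrr.
  have := lamD w (y - w) uS; rewrite addrC subrK ht => h3.
  have := lam_mulrz N0%:Z t uS; have := Qb _ x0Q; rewrite x0E => h4 h5.
  have h6 : (`|t| * lam S N0%:Z <= `|t| * b)%N by rewrite leq_mul.
  have h7 : (N0 * `|t| <= `|y| + 3 * i * N0)%N.
    have := abszM N0%:Z t; rewrite absz_nat -ht => <-; lia.
  have h8 : (lam S y <= 3 * i * b + `|t| * b)%N by lia.
  apply: (@leq_trans (N0 * (3 * i * b + `|t| * b))); first by rewrite leq_mul2l h8 orbT.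
  have : (N0 * `|t| * b <= (`|y| + 3 * i * N0) * b)%N by rewrite leq_mul2r h7 orbT.
  lia.
pose s := size S.
pose Y := [seq (k : nat)%:Z - s%:Z | k <- iota 0 s.*2.+1].
have uY : uniq Y by rewrite map_inj_uniq ?iota_uniq // => u v /addIr [].
have sY : size Y = s.*2.+1 by rewrite size_map size_iota.
have h1 := lam_avg uS uY; rewrite sY -/s in h1.
have h2 : (N0 * \sum_(y <- Y) lam S y <= (s * s.+1 + s.*2.+1 * (6 * i * N0)) * b)%N.
  rewrite big_distrr /=.
  apply: (@leq_trans (\sum_(y <- Y) (`|y| + 6 * i * N0) * b)).
    by apply: leq_sum => y _; exact: lamy.
  rewrite -big_distrl /= leq_mul2r big_split /= /Y !big_map sum_absz_sym.
  by rewrite big_const_seq count_predT iter_addn_0 size_iota [(6 * _ * _ * _)%N]mulnC leqnn orbT.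
have h3 : (N0 * (s * s.+1) <= (s * s.+1 + s.*2.+1 * (6 * i * N0)) * b)%N.
  have aux u z : (u.*2.+1 * u <= u * u + z -> u * u.+1 <= z)%N.
    by rewrite -addnn mulSn mulnDl mulnS; lia.
  by apply: leq_trans h2; rewrite leq_mul2l aux ?orbT.
(* The factor 120 makes the total cost of the lifts at most a tenth of the main term, whence
   10/11. *)
have h4 : (10 * (s.*2.+1 * (6 * i * N0)) <= s * s.+1)%N.
  apply: (@leq_trans (s.+1 * (120 * i * N0))); last by rewrite mulnC leq_mul.
  have : (s.*2.+1 <= 2 * s.+1)%N by lia.
  move: (s.*2.+1) (i * N0)%N (mulnA 6 i N0) (mulnA 120 i N0) => u v <- <-; nia.
have s0 : (0 < s * s.+1)%N.
  have [e|] := posnP i; first by move: hi; rewrite e; lia.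
  by move=> i0; rewrite muln_gt0 andbT (leq_trans _ hS) // !muln_gt0 i0 /=; lia.
move: s0 h3 h4; move: (s * s.+1)%N (s.*2.+1 * _)%N => u v u0 h3 h4.
have : (10 * (N0 * u) <= 11 * (u * b))%N.
  have : (10 * ((u + v) * b) <= 11 * (u * b))%N by rewrite !mulnA -mulnA mulnDl; nia.
  lia.
by move=> h; rewrite -(leq_pmul2l u0); lia.
Qed.

(** * Growing a set of subset sums *)

Definition rep n (S0 : seq int) (F : {set 'I_n.+1}) (z : int) : Prop :=
  exists2 e, e \in S0 & exists2 F' : {set 'I_n.+1}, F' \subset F &
    z = e + Posz (\sum_(x in F') (x : nat))%N.

Definition grown n (P : {set 'I_n.+1}) (S0 : seq int) (t R : nat)
    (F : {set 'I_n.+1}) (S : seq int) : Prop :=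
  [/\ F \subset P, (#|F| <= t)%N, uniq S, (forall z, z \in S -> 0 <= z <= Posz R)
    & (forall z, z \in S -> rep S0 F z)].

(** The three clauses survive any [U] deletions and feed the growth bounds: [m0] is the growth rate
    of balls, the large element serves as modulus, and the last clause makes the Cayley graph
    connected. *)
Definition robust n (P : {set 'I_n.+1}) (U m0 N : nat) : Prop :=
  forall F : {set 'I_n.+1}, F \subset P -> (#|F| <= U)%N ->
  [/\ (m0 <= #|P :\: F|)%N, (exists2 x, x \in P :\: F & (N <= 2 * x)%N)
    & (forall q, (1 < q)%N -> exists2 x, x \in P :\: F & ~~ (q %| x)%N)].

Lemma grown_le n (P : {set 'I_n.+1}) (S0 : seq int) t t' R R' F S : (t <= t')%N -> (R <= R')%N ->
  grown P S0 t R F S -> grown P S0 t' R' F S.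
Proof.
move=> tt RR [h1 h2 h3 h4 h5]; split=> //; first exact: leq_trans tt.
by move=> z /h4; lia.
Qed.

Lemma grown_size n (P : {set 'I_n.+1}) (S0 : seq int) t R F S :
  grown P S0 t R F S -> (size S <= R.+1)%N.
Proof.
case=> _ _ uS hS _; rewrite -[R.+1](size_iota 0) -(size_map Posz).
apply: uniq_leq_size => // z /hS h; apply/mapP; exists `|z|%N; last lia.
by rewrite mem_iota; lia.
Qed.

Lemma grown_step n (P : {set 'I_n.+1}) (S0 : seq int) t R F S (x : 'I_n.+1) : x \in P :\: F ->
  grown P S0 t R F S -> grown P S0 t.+1 (R + x) (x |: F) (grow S (Posz x)).
Proof.
rewrite inE => /andP[xF xP] [h1 h2 h3 h4 h5]; split.
- by rewrite subUset sub1set xP.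
- by rewrite cardsU1 xF.
- exact: uniq_grow.
- by move=> z /mem_grow[/h4|[w /h4 ? ->]]; lia.
move=> z /mem_grow[/h5[e eS [F' sF ->]]|[w /h5[e eS [F' sF ->]] ->]].
  by exists e => //; exists F' => //; rewrite subsetU // sF orbT.
exists e => //; exists (x |: F'); first by rewrite setUS.
rewrite big_setU1 /=; last by apply: contra xF; apply: (subsetP sF).
by rewrite PoszD -addrA; congr (_ + _); rewrite addrC.
Qed.

Lemma best_step n (P : {set 'I_n.+1}) (S0 : seq int) U m0 N i1 t R F S :
  robust P U m0 N -> (forall x, x \in P -> (0 < x <= N)%N) -> (2 < N)%N ->
  (N <= i1 * m0)%N -> grown P S0 t R F S -> (t <= U)%N ->
  exists x : 'I_n.+1, let b := lam S (Posz x) in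
  [/\ (x <= N)%N, grown P S0 t.+1 (R + x) (x |: F) (grow S (Posz x)),
      (2 * size S <= m0 -> size S <= 2 * b)%N,
      (forall i, 4 * size S <= i * minn N (2 * (i * m0)) -> size S <= 8 * i * b)%N
    & (120 * i1 * N <= size S -> 10 * x <= 11 * b /\ 5 * N <= 11 * b)%N].
Proof.
move=> rob PN N2 hi1 gr tU; have [sF cF uS _ _] := gr.
have [cQ [x1 x1Q hx1] gcdQ] := rob F sF (leq_trans cF tU).
set Q := P :\: F in cQ x1Q gcdQ.
case: (arg_maxnP (fun x : 'I_n.+1 => lam S (Posz x)) x1Q) => x xQ xmax.
case: (arg_maxnP (fun x : 'I_n.+1 => nat_of_ord x) x1Q) => x0 x0Q x0max.
have QP y : y \in Q -> y \in P by rewrite inE => /andP[].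
have x0N : (N <= 2 * x0)%N by have := x0max _ x1Q; rewrite /=; lia.
have QN y : y \in Q -> (0 < y <= x0)%N.
  by move=> yQ; have := x0max _ yQ; have := PN _ (QP _ yQ); rewrite /=; lia.
have Qb y : y \in Q -> (lam S (Posz y) <= lam S (Posz x))%N by exact: xmax.
have N1 : (1 < x0)%N by lia.
exists x; split.
- by case/andP: (PN _ (QP _ xQ)).
- exact: grown_step.
- by move=> h; apply: (pool_growth uS Qb); apply: leq_trans cQ.
- move=> i h; apply: (quadratic_growth x0Q erefl N1 uS QN Qb gcdQ).
  have : (i * minn N (2 * (i * m0)) <= 2 * (i * minn x0 (i * #|Q|)))%N.
    rewrite [X in (_ <= X)%N]mulnCA leq_mul2l; apply/orP; right.
    have : (i * m0 <= i * #|Q|)%N by rewrite leq_mul2l cQ orbT.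
    by move: (i * m0)%N (i * #|Q|)%N => u v; lia.
  by move: h; move: (i * minn N _)%N (i * minn x0 _)%N (size S) => u v s; lia.
move=> h.
have h10 : (10 * x0 <= 11 * lam S (Posz x))%N.
  apply: (dense_growth (i := i1) x0Q erefl N1 uS QN Qb gcdQ).
    apply: leq_trans (_ : N <= _)%N; first by case/andP: (PN _ (QP _ x0Q)).
    by rewrite (leq_trans hi1) // leq_mul2l cQ orbT.
  apply: leq_trans h; rewrite leq_mul2l; apply/orP; right.
  by case/andP: (PN _ (QP _ x0Q)).
by have /andP[_ xx0] := QN _ xQ; lia.
Qed.

(** While [2 size S < m0], a step multiplies the size by at least 3/2, so two steps at least double
    it. *)
Lemma startup n (P : {set 'I_n.+1}) (S0 : seq int) U m0 N i1 k :
  robust P U m0 N -> (forall x, x \in P -> (0 < x <= N)%N) -> (2 < N)%N ->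
  (N <= i1 * m0)%N -> uniq S0 -> (forall z, z \in S0 -> 0 <= z <= Posz N) ->
  (2 * k <= U)%N ->
  exists F S, grown P S0 (2 * k) (N * (1 + 2 * k)) F S /\
    ((m0 <= 2 * size S)%N \/ (2 ^ k * size S0 <= size S)%N).
Proof.
move=> rob PN N2 hi1 uS0 S0N; elim: k => [|k IH] hk.
  exists set0, S0; split; last by right; rewrite mul1n.
  split=> //; rewrite ?sub0set ?cards0 //; first by rewrite muln1.
  by move=> z zS; exists z => //; exists set0; rewrite ?sub0set // big_set0 addr0.
have [|F [S [gr hS]]] := IH; first lia.
have stay : (m0 <= 2 * size S)%N -> exists F S, grown P S0 (2 * k.+1) (N * (1 + 2 * k.+1)) F S /\
    ((m0 <= 2 * size S)%N \/ (2 ^ k.+1 * size S0 <= size S)%N).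
  move=> h; exists F, S; split; last by left.
  by apply: grown_le gr; [lia | rewrite leq_mul2l; lia].
have [/stay//|lt] := leqP m0 (2 * size S).
have {hS} hS : (2 ^ k * size S0 <= size S)%N by case: hS => // h; lia.
have [|x [xN gr1 h1 _ _]] := best_step rob PN N2 hi1 gr; first lia.
have {}h1 := h1 (ltnW lt).
have [le2|lt2] := leqP m0 (2 * size (grow S (Posz x))).
  exists (x |: F), (grow S (Posz x)); split; last by left.
  by apply: grown_le gr1; lia.
have [|y [yN gr2 h2 _ _]] := best_step rob PN N2 hi1 gr1; first lia.
have {}h2 := h2 (ltnW lt2).
exists (y |: (x |: F)), (grow (grow S (Posz x)) (Posz y)); split.
  by apply: grown_le gr2; lia.
right; rewrite expnS -mulnA; move: h2; rewrite !size_grow; lia.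
Qed.

(** Below the threshold of level [i], each step gains at least [size S / (8 i)], because sizes never
    decrease. *)
Lemma quadratic_block n (P : {set 'I_n.+1}) (S0 : seq int) U m0 N i1 t F S i j :
  robust P U m0 N -> (forall x, x \in P -> (0 < x <= N)%N) -> (2 < N)%N ->
  (N <= i1 * m0)%N -> (t + j <= U)%N -> grown P S0 t (N * (1 + t)) F S ->
  exists F' S', [/\ grown P S0 (t + j) (N * (1 + (t + j))) F' S', (size S <= size S')%N
    & (i * minn N (2 * (i * m0)) <= 4 * size S')%N \/
      (j * size S + 8 * i * size S <= 8 * i * size S')%N].
Proof.
move=> rob PN N2 hi1; elim: j => [|j IH] hj gr.
  by exists F, S; rewrite addn0; split=> //; right; rewrite mul0n add0n.
have hj' : (t + j <= U)%N by lia.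
have [F1 [S1 [gr1 ss1 h1]]] := IH hj' gr.
have [|x [xN gr2 _ h2 _]] := best_step rob PN N2 hi1 gr1; first lia.
exists (x |: F1), (grow S1 (Posz x)); rewrite size_grow; split; last 1 first.
- have [le|lt] := leqP (i * minn N (2 * (i * m0))) (4 * size S1); first by left; lia.
  right; have {}h2 := h2 _ (ltnW lt).
  have {}h1 : (j * size S + 8 * i * size S <= 8 * i * size S1)%N by case: h1 => //; lia.
  by rewrite mulSn mulnDr; lia.
- by rewrite -addSnnS in gr2 *; apply: grown_le gr2; lia.
by lia.
Qed.

Lemma quadratic_phase n (P : {set 'I_n.+1}) (S0 : seq int) U m0 N i1 t F S i :
  robust P U m0 N -> (forall x, x \in P -> (0 < x <= N)%N) -> (2 < N)%N ->
  (N <= i1 * m0)%N -> grown P S0 t (N * (1 + t)) F S -> (m0 <= 2 * size S)%N ->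
  (t + 48 * i <= U)%N ->
  exists F' S', grown P S0 (t + 48 * i) (N * (1 + (t + 48 * i))) F' S' /\
    (i.+1 * minn N (2 * (i.+1 * m0)) <= 4 * size S')%N.
Proof.
move=> rob PN N2 hi1 gr hS; elim: i => [|i IH] hi.
  by exists F, S; rewrite muln0 addn0 !mul1n; split=> //; lia.
have [|F1 [S1 [gr1 h1]]] := IH; first lia.
have [|F2 [S2 [gr2 ss h2]]] := quadratic_block i.+2 (j := 48) rob PN N2 hi1 _ gr1; first lia.
exists F2, S2; split; first by rewrite (_ : t + 48 * i.+1 = t + 48 * i + 48)%N //; lia.
case: h2 => // h2.
have g1 : (i.+1 * minn N (2 * (i.+2 * m0)) <= i.+2 * minn N (2 * (i.+1 * m0)))%N.
  by rewrite !minnMr; lia.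
move: h1 h2 g1; move: (size S1) (size S2) (minn N (2 * (i.+1 * m0))) (minn N (2 * (i.+2 * m0))).
move=> s1 s2 g g' h1 h2 g1.
(* The 48 steps multiply the size by at least [(i+8)/(i+2)], which is at least the square of
   [(i+2)/(i+1)], a bound for the ratio of consecutive thresholds. *)
have e1 : (s1 * (i + 8) <= s2 * i.+2)%N by lia.
rewrite -(@leq_pmul2l i.+2) // -(@leq_pmul2l i.+1) //.
have : (i.+1 * g' * (i.+2 * i.+2) <= i.+2 * g * (i.+2 * i.+2))%N by rewrite leq_mul2r g1 orbT.
have : (i.+2 * (i.+2 * i.+2) * g <= i.+1 * (i.+1 * (i + 8)) * g)%N.
  by rewrite leq_mul2r; apply/orP; right; nia.
have : (i.+1 * g * (i.+1 * (i + 8)) <= 4 * s1 * (i.+1 * (i + 8)))%N by rewrite leq_mul2r h1 orbT.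
have : (i.+1 * (s1 * (i + 8)) <= i.+1 * (s2 * i.+2))%N by rewrite leq_mul2l e1 orbT.
lia.
Qed.

(** A step by [x] lengthens the range [R] by [x] and the set by at least [10 x / 11], so density
    tends to 10/11. The process stops when [R] passes five times its initial value, overshooting by
    at most [N]. *)
Lemma dense_phase n (P : {set 'I_n.+1}) (S0 : seq int) U m0 N i1 T0 F S j :
  robust P U m0 N -> (forall x, x \in P -> (0 < x <= N)%N) -> (2 < N)%N ->
  (N <= i1 * m0)%N -> grown P S0 T0 (N * (1 + T0)) F S -> (120 * i1 * N <= size S)%N ->
  (T0 + j <= U)%N ->
  exists F' S' R, [/\ grown P S0 (T0 + j) R F' S', (10 * R <= 11 * size S' + 10 * (N * (1 + T0)))%N
    & (5 * (N * (1 + T0)) <= R <= 5 * (N * (1 + T0)) + N)%N \/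
      [/\ (R < 5 * (N * (1 + T0)))%N, (120 * i1 * N <= size S')%N & (5 * N * j <= 11 * size S')%N]].
Proof.
move=> rob PN N2 hi1 gr hS; elim: j => [|j IH] hj.
  exists F, S, (N * (1 + T0))%N; rewrite addn0; split=> //; first lia.
  by right; split=> //; [lia | rewrite muln0].
have [|F1 [S1 [R [gr1 h1 h2]]]] := IH; first lia.
case: h2 => [h2|[h2 h3 h4]].
  by exists F1, S1, R; split=> //; [apply: grown_le gr1; lia | left].
have [|x [xN gr2 _ _ /(_ h3)[h5 h6]]] := best_step rob PN N2 hi1 gr1; first lia.
exists (x |: F1), (grow S1 (Posz x)), (R + x)%N; rewrite size_grow; split.
- by rewrite addnS.
- lia.
have [le|lt] := leqP (5 * (N * (1 + T0))) (R + x); [left; lia | right].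
by rewrite mulnS; split=> //; lia.
Qed.

Lemma growth n (P : {set 'I_n.+1}) (S0 : seq int) m0 N i1 k :
  let T0 := (2 * k + 48 * (480 * i1))%N in
  robust P (12 * (1 + T0)) m0 N -> (forall x, x \in P -> (0 < x <= N)%N) -> (2 < N)%N ->
  (N <= i1 * m0)%N -> uniq S0 -> (forall z, z \in S0 -> 0 <= z <= Posz N) ->
  (m0 <= 2 * (2 ^ k * size S0))%N ->
  exists F S, grown P S0 (12 * (1 + T0)) (5 * (N * (1 + T0)) + N) F S /\
    (40 * (N * (1 + T0)) <= 11 * size S)%N.
Proof.
move=> T0; have T0E : T0 = (2 * k + 48 * (480 * i1))%N by [].
clearbody T0; move=> rob PN N2 hi1 uS0 S0N hm0.
have [|F [S [gr hS]]] := startup (k := k) rob PN N2 hi1 uS0 S0N; first lia.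
have {}hS : (m0 <= 2 * size S)%N by case: hS => //; lia.
have i10 : (0 < i1)%N by case: (i1) hi1 => //; lia.
(* At level [480 i1] the minimum equals [N], so the size is at least [120 i1 N], as the dense phase
   requires. *)
have [|F1 [S1 [gr1 h1]]] := quadratic_phase (i := 480 * i1) rob PN N2 hi1 gr hS; first lia.
have eT : (2 * k + 48 * (480 * i1) = T0)%N by lia.
rewrite eT in gr1.
have h2 : (120 * i1 * N <= size S1)%N.
  have e : minn N (2 * ((480 * i1).+1 * m0)) = N by apply/minn_idPl; lia.
  by move: h1; rewrite e; lia.
have [|F2 [S2 [R [gr2 h3 h4]]]] :=
  dense_phase (j := 11 * (1 + T0) + 1) rob PN N2 hi1 gr1 h2; first lia.
exists F2, S2; case: h4 => [h4|[h4 _ h5]].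
  by split; [apply: grown_le gr2; lia | lia].
(* After [11 (1 + T0) + 1] steps with gain at least [5 N / 11], the set would be larger than its
   range. *)
exfalso; have := grown_size gr2; move: h4 h5.
have -> : (5 * N * (11 * (1 + T0) + 1) = 11 * (5 * (N * (1 + T0))) + 5 * N)%N by lia.
lia.
Qed.

(** * Intervals *)

(** Pigeonhole: [X] and [L + j - Y] lie in [[0, L + j]] and are together too large to be
    disjoint. *)
Lemma sumset_interval (X Y : seq int) (L s j : nat) : uniq X -> uniq Y ->
  (forall z, z \in X -> 0 <= z <= Posz L) -> (forall z, z \in Y -> 0 <= z <= Posz L) ->
  (L + 1 + s <= size X + size Y)%N -> (j < s)%N ->
  exists x y, [/\ x \in X, y \in Y & x + y = Posz (L + j)].
Proof.
move=> uX uY hX hY hs js.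
pose Z := [seq Posz (L + j) - y | y <- Y].
have uZ : uniq Z by rewrite map_inj_uniq // => u v /addrI /oppr_inj.
case: (boolP (has (mem X) Z)) => [/hasP[x /mapP[y yY ->] xX]|hXZ].
  by exists (Posz (L + j) - y), y; split=> //; rewrite subrK.
have uXZ : uniq (X ++ Z) by rewrite cat_uniq uX hXZ uZ.
have : (size (X ++ Z) <= (L + j).+1)%N.
  rewrite -[(L + j).+1](size_iota 0) -(size_map Posz); apply: uniq_leq_size => // z.
  rewrite mem_cat => h; have {h} h : 0 <= z <= Posz (L + j).
    case/orP: h => [/hX h|/mapP[y /hY h ->]]; lia.
  by apply/mapP; exists `|z|%N; rewrite ?mem_iota; lia.
rewrite size_cat size_map => h; exfalso; move: (size X) (size Y) hs h js => x y; lia.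
Qed.

(** * Sums of boundedly many elements *)

Definition ssum n (G : {set 'I_n.+1}) (h z : nat) : Prop :=
  exists F : {set 'I_n.+1}, [/\ F \subset G, (#|F| <= h)%N & (\sum_(x in F) (x : nat))%N = z].

Lemma ssumW n (G G' : {set 'I_n.+1}) h h' z :
  G \subset G' -> (h <= h')%N -> ssum G h z -> ssum G' h' z.
Proof.
move=> sG hh [F [sF cF sz]]; exists F; split=> //; first exact: subset_trans sG.
exact: leq_trans hh.
Qed.

Lemma ssumD n (G G' : {set 'I_n.+1}) h h' z z' : [disjoint G & G'] ->
  ssum G h z -> ssum G' h' z' -> ssum (G :|: G') (h + h') (z + z').
Proof.
move=> dG [F [sF cF <-]] [F' [sF' cF' <-]].
have dF : [disjoint F & F'] by apply: disjointWl sF _; apply: disjointWr sF' dG.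
exists (F :|: F'); split; first exact: setUSS.
  by rewrite cardsU disjoint_setI0 // cards0 subn0 leq_add.
rewrite (big_setID F) /= setUK setDUl setDv set0U (setDidPl _) //.
by rewrite disjoint_sym.
Qed.

(** For [x <= N], an interval of length at least [N] and its translate by [x] leave no gap, so each
    new element lengthens the interval by [x]. *)
Lemma ssum_extend n (G X : {set 'I_n.+1}) h a N j : [disjoint G & X] ->
  (forall i, (i < N)%N -> ssum G h (a + i)) -> (forall x, x \in X -> (x <= N)%N) ->
  (j < N + \sum_(x in X) (x : nat))%N -> ssum (G :|: X) (h + #|X|) (a + j).
Proof.
move=> + hG; have [k] := ubnP #|X|; elim: k X j => // k IH X j cX dG XN.
have [->|[x xX]] := set_0Vmem X; first by rewrite big_set0 addn0 cards0 addn0 setU0; apply: hG.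
rewrite (big_setD1 x) //= (cardsD1 x) xX => hj.
have cX' : (#|X :\ x| < k)%N by move: cX; rewrite (cardsD1 x) xX.
have dX : [disjoint G & X :\ x] by apply: disjointWr dG; apply: subsetDl.
have XN' y : y \in X :\ x -> (y <= N)%N by rewrite !inE => /andP[_ /XN].
have [lt|le] := ltnP j (N + \sum_(y in X :\ x) (y : nat)).
  by apply: ssumW (IH _ _ cX' dX XN' lt); [rewrite setUS ?subsetDl | lia].
have xN := XN _ xX.
have lt : (j - x < N + \sum_(y in X :\ x) (y : nat))%N.
  by move: (\sum_(y in X :\ x) _)%N hj le => s; lia.
have -> : (a + j = (a + (j - x)) + x)%N by move: (\sum_(y in X :\ x) _)%N le => s; lia.
have -> : G :|: X = (G :|: X :\ x) :|: [set x] by rewrite -setUA [_ :|: [set x]]setUC setD1K.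
rewrite [(true + _)%N]addnC addnA; apply: ssumD (IH _ _ cX' dX XN' lt) _.
  rewrite disjoint_sym disjoints1 !inE eqxx /= orbF.
  by apply: contraTN xX => xG; rewrite (disjointFr dG).
by exists [set x]; rewrite subxx cards1 big_set1.
Qed.

Lemma robustW n (P F1 : {set 'I_n.+1}) U U' m0 N : F1 \subset P -> (#|F1| <= U)%N ->
  robust P (U + U') m0 N -> robust (P :\: F1) U' m0 N.
Proof.
move=> s1 c1 rob F sF cF; rewrite setDDl; apply: rob.
  by rewrite subUset s1 (subset_trans sF) ?subsetDl.
by rewrite cardsU; lia.
Qed.

Lemma rep_ssum n (E F : {set 'I_n.+1}) (S0 : seq int) t z : [disjoint E & F] ->
  (#|F| <= t)%N -> (forall e, e \in S0 -> exists2 u, e = Posz u & ssum E 1 u) ->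
  rep S0 F z -> exists2 u, z = Posz u & ssum (E :|: F) (1 + t) u.
Proof.
move=> dEF ct hS0 [e /hS0[u -> hu] [F' sF' ->]].
exists (u + \sum_(x in F') (x : nat))%N; first by rewrite PoszD.
by apply: ssumD => //; exists F'; split=> //; apply: leq_trans ct; exact: subset_leq_card.
Qed.

(** The second growth runs in what the first leaves of the pool, hence the doubled deletion budget.
    The 2 in the number of summands allows one starting element on each side. *)
Lemma two_growth_interval n (P E1 E2 : {set 'I_n.+1}) (S1 S2 : seq int) m0 N i1 k :
  let U := (12 * (1 + (2 * k + 48 * (480 * i1))))%N in
  robust P (U + U) m0 N -> (forall x, x \in P -> (0 < x <= N)%N) -> (2 < N)%N ->
  (N <= i1 * m0)%N ->
  [disjoint E1 & P] -> [disjoint E2 & P] -> [disjoint E1 & E2] ->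
  uniq S1 -> uniq S2 ->
  (forall z, z \in S1 -> 0 <= z <= Posz N) -> (forall z, z \in S2 -> 0 <= z <= Posz N) ->
  (forall e, e \in S1 -> exists2 u, e = Posz u & ssum E1 1 u) ->
  (forall e, e \in S2 -> exists2 u, e = Posz u & ssum E2 1 u) ->
  (m0 <= 2 * (2 ^ k * size S1))%N -> (m0 <= 2 * (2 ^ k * size S2))%N ->
  exists (G : {set 'I_n.+1}) (a : nat), [/\ G \subset P, (#|G| <= U + U)%N &
    forall j, (j < N)%N -> ssum (E1 :|: E2 :|: G) (2 + (U + U)) (a + j)].
Proof.
move=> U rob PN N2 hi1 d1 d2 d12 u1 u2 r1 r2 e1 e2 m1 m2.
have i10 : (0 < i1)%N by case: (i1) hi1 => //; lia.
pose T0 := (2 * k + 48 * (480 * i1))%N.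
have UE : U = (12 * (1 + T0))%N by [].
have T02 : (3 <= 1 + T0)%N by rewrite /T0; lia.
have rob1 : robust P U m0 N by move=> F sF cF; apply: rob => //; lia.
have [F1 [X [g1 s1]]] := growth (k := k) rob1 PN N2 hi1 u1 r1 m1.
have [sF1 cF1 uX hX rX] := g1.
have rob2 : robust (P :\: F1) U m0 N by apply: robustW rob.
have PN2 x : x \in P :\: F1 -> (0 < x <= N)%N by rewrite inE => /andP[_ /PN].
have [F2 [Y [g2 s2]]] := growth (k := k) rob2 PN2 N2 hi1 u2 r2 m2.
have [sF2 cF2 uY hY rY] := g2.
rewrite -/T0 -/U in s1 s2 cF1 cF2 hX hY.
clear rob rob1 rob2 g1 g2 UE; clearbody U T0.
have sF2P : F2 \subset P by apply: subset_trans sF2 (subsetDl _ _).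
have dF : [disjoint F1 & F2].
  by rewrite disjoint_sym; move: sF2; rewrite subsetD => /andP[].
exists (F1 :|: F2), (5 * (N * (1 + T0)) + N)%N; split.
- by rewrite subUset sF1.
- by rewrite cardsU; lia.
move=> j jN.
(* The two sizes add up to at least 80/11 of [N (1 + T0)]; the excess over 5 absorbs [2 N + 1]
   because [1 + T0 >= 3]. *)
have hs : (5 * (N * (1 + T0)) + N + 1 + N <= size X + size Y)%N.
  have h : (N * 3 <= N * (1 + T0))%N by rewrite leq_mul2l (leq_trans _ T02) ?orbT.
  by move: N2 h s1 s2; move: (N * (1 + T0))%N (size X) (size Y); clear; lia.
have [x [y [xX yY xy]]] := sumset_interval uX uY hX hY hs jN.
have dE1 : [disjoint E1 & F1] by apply: disjointWr d1.
have dE2 : [disjoint E2 & F2] by apply: disjointWr d2.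
have [u ux hu] := rep_ssum dE1 cF1 e1 (rX _ xX).
have [v vy hv] := rep_ssum dE2 cF2 e2 (rY _ yY).
have -> : (5 * (N * (1 + T0)) + N + j = u + v)%N.
  by apply/eqP; rewrite -(eqr_nat int) !natz -xy ux vy -PoszD.
have -> : E1 :|: E2 :|: (F1 :|: F2) = (E1 :|: F1) :|: (E2 :|: F2) by rewrite setUACA.
have -> : (2 + (U + U) = (1 + U) + (1 + U))%N by clear; lia.
apply: ssumD hu hv.
rewrite -setI_eq0 setIUl !setIUr !(disjoint_setI0, set0U) ?eqxx //.
- by rewrite disjoint_sym; apply: disjointWr d2.
- by apply: disjointWr d1.
Qed.

Local Close Scope ring_scope.
Local Open Scope nat_scope.

(** * Long intervals from a robust pool *)

Definition nonmult n (A : {set 'I_n.+1}) (q : nat) : {set 'I_n.+1} :=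
  [set x in A | ~~ (q %| x)].

Lemma card_inj_bound (T : finType) (A : {set T}) (f : T -> nat) t :
  {in A &, injective f} -> (forall x, x \in A -> f x < t) -> #|A| <= t.
Proof.
move=> fi ft; rewrite cardE -(size_map f) -[t](size_iota 0); apply: uniq_leq_size.
  by rewrite map_inj_in_uniq ?enum_uniq // => x y; rewrite !mem_enum; apply: fi.
by move=> u /mapP[x]; rewrite mem_enum mem_iota => xA ->; apply: ft.
Qed.

Lemma card_lt_bound n (A : {set 'I_n.+1}) t : #|[set x in A | x < t]| <= t.
Proof.
apply: (@card_inj_bound _ _ (@nat_of_ord _)) => [x y _ _ /val_inj //|x].
by rewrite inE => /andP[].
Qed.

Lemma card_le_bound n (A : {set 'I_n.+1}) N :
  (forall x, x \in A -> 0 < x <= N) -> #|A| <= N.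
Proof.
move=> AN; apply: (@card_inj_bound _ _ (fun x : 'I_n.+1 => x.-1)) => [x y xA yA e|x xA].
  by apply/val_inj; have := AN _ xA; have := AN _ yA; move: e => /=; lia.
by have := AN _ xA; lia.
Qed.

Lemma card_nonmult_ge n (A : {set 'I_n.+1}) N q : 0 < q ->
  (forall x, x \in A -> 0 < x <= N) -> #|A| <= #|nonmult A q| + N %/ q.
Proof.
move=> q0 AN; rewrite -(cardsID (nonmult A q) A).
have -> : A :&: nonmult A q = nonmult A q by apply/setIidPr/subsetP => x; rewrite inE => /andP[].
rewrite leq_add2l; apply: (@card_inj_bound _ _ (fun x : 'I_n.+1 => (x %/ q).-1)).
  move=> x y; rewrite !inE => /andP[+ xA] /andP[+ yA]; rewrite xA yA /= !negbK.
  move=> /dvdnP[a ea] /dvdnP[b eb]; have := AN _ xA; have := AN _ yA.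
  rewrite ea eb !mulnK // !muln_gt0 => /andP[/andP[b0 _] _] /andP[/andP[a0 _] _] e.
  by apply/val_inj; rewrite /= ea eb; congr (_ * _); lia.
move=> x; rewrite !inE => /andP[+ xA]; rewrite xA /= negbK => /dvdnP[a ea].
have /andP[x0 xN] := AN _ xA.
have := leq_div2r q xN; rewrite ea mulnK //; move: x0; rewrite ea muln_gt0; lia.
Qed.

Lemma exists_subset_card (T : finType) (A : {set T}) k : k <= #|A| ->
  exists2 B : {set T}, B \subset A & #|B| = k.
Proof.
move=> kA; exists [set x in take k (enum A)].
  by apply/subsetP => x; rewrite inE => /mem_take; rewrite mem_enum.
rewrite cardsE; have /card_uniqP -> : uniq (take k (enum A)) by rewrite take_uniq ?enum_uniq.
by rewrite size_takel // -cardE.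
Qed.

Lemma robust_intro n (P : {set 'I_n.+1}) U m0 N :
  m0 + U <= #|P| -> U < #|[set x in P | N <= 2 * x]| ->
  (forall q, 1 < q -> U < #|nonmult P q|) -> robust P U m0 N.
Proof.
move=> h1 h2 h3 F sF cF.
have ex (B : {set 'I_n.+1}) : U < #|B| -> exists2 x, x \in B & x \notin F.
  move=> hB; apply/subsetPn; apply/negP => /subset_leq_card; lia.
split; first by rewrite cardsD (setIidPr sF); lia.
  by have [x] := ex _ h2; rewrite inE => /andP[xP xN] xF; exists x; rewrite ?inE ?xF.
by move=> q /h3 /ex[x]; rewrite inE => /andP[xP xN] xF; exists x; rewrite ?inE ?xF.
Qed.

Lemma interval_of_pool n (A2 P E1 E2 : {set 'I_n.+1}) (S1 S2 : seq int) m0 N i1 k w :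
  let U := (12 * (1 + (2 * k + 48 * (480 * i1)))) in
  robust P (U + U) m0 N -> (forall x, x \in A2 -> 0 < x <= N) -> 2 < N ->
  N <= i1 * m0 -> P \subset A2 -> E1 \subset A2 -> E2 \subset A2 ->
  #|E1| <= m0 -> #|E2| <= m0 ->
  [disjoint E1 & P] -> [disjoint E2 & P] -> [disjoint E1 & E2] ->
  uniq S1 -> uniq S2 ->
  (forall e, e \in S1 -> exists2 u, e = Posz u & ssum E1 1 u) ->
  (forall e, e \in S2 -> exists2 u, e = Posz u & ssum E2 1 u) ->
  (forall z, z \in S1 -> 0 <= z <= Posz N)%R -> (forall z, z \in S2 -> 0 <= z <= Posz N)%R ->
  m0 <= 2 * (2 ^ k * size S1) -> m0 <= 2 * (2 ^ k * size S2) ->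
  3 * m0 + (U + U) + w <= #|A2| ->
  exists a, forall j, j < w * m0 -> ssum A2 (2 + (U + U) + w) (a + j).
Proof.
move=> U rob AN N2 hi1 sP s1 s2 c1 c2 d1 d2 d12 u1 u2 e1 e2 r1 r2 m1 m2 hA.
have PN x : x \in P -> 0 < x <= N by move/(subsetP sP)/AN.
have [G [a [sG cG hG]]] :=
  two_growth_interval rob PN N2 hi1 d1 d2 d12 u1 u2 r1 r2 e1 e2 m1 m2.
rewrite -/U in cG hG; clear m1 m2 rob; clearbody U.
set G' := E1 :|: E2 :|: G in hG.
have sG' : G' \subset A2 by rewrite !subUset s1 s2 (subset_trans sG).
have cG' : #|G'| <= 2 * m0 + (U + U) by rewrite !cardsU; lia.
have [X sX cX] : exists2 X : {set 'I_n.+1},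
    X \subset [set x in A2 :\: G' | m0 <= x] & #|X| = w.
  apply: exists_subset_card.
  have := cardsID [set x : 'I_n.+1 | x < m0] (A2 :\: G').
  have -> : (A2 :\: G') :&: [set x : 'I_n.+1 | x < m0] = [set x in A2 :\: G' | x < m0].
    by apply/setP => x; rewrite !inE.
  have -> : (A2 :\: G') :\: [set x : 'I_n.+1 | x < m0] = [set x in A2 :\: G' | m0 <= x].
    by apply/setP => x; rewrite !inE -leqNgt andbC.
  have := card_lt_bound (A2 :\: G') m0.
  set B1 := [set x in A2 :\: G' | x < m0]; set B2 := [set x in A2 :\: G' | m0 <= x].
  have -> : #|A2 :\: G'| = #|A2| - #|G'| by rewrite cardsD (setIidPr sG').
  move: cG' hA; move: #|A2| #|G'| #|B1| #|B2|.
  by clear; lia.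
have XA x : x \in X -> [/\ x \in A2, x \notin G' & m0 <= x].
  by move/(subsetP sX); rewrite !inE => /andP[/andP[-> ->] ->].
have dX : [disjoint G' & X].
  rewrite disjoint_sym disjoint_subset; apply/subsetP => x /XA[_ xG _]; exact: xG.
have sumX : w * m0 <= \sum_(x in X) (x : nat).
  by rewrite -cX -sum_nat_const; apply: leq_sum => x /XA[].
exists a => j hj.
have XN x : x \in X -> x <= N by case/XA => /AN/andP[].
have := ssum_extend (j := j) dX hG XN; rewrite cX => hh.
apply: ssumW (leqnn _) (hh _).
  by rewrite subUset sG' /=; apply/subsetP => x /XA[].
by apply: leq_trans hj (leq_trans sumX _); rewrite leq_addl.
Qed.

(* [T := 2 k + 48 (480 i1)] steps of startup and quadratic growth, followed by
   [11 (1 + T) + 1] steps that reach positive density. *)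
Definition steps (k i1 : nat) : nat := 12 * (1 + (2 * k + 48 * (480 * i1))).

Lemma sparse_interval n (A2 : {set 'I_n.+1}) m0 N i1 k w (U := steps k i1) :
  (forall x, x \in A2 -> 0 < x <= N) -> 2 < N -> N <= i1 * m0 -> m0 <= 2 ^ k ->
  U + U < #|[set x in A2 | N <= 2 * x]| ->
  (forall q, 1 < q -> U + U < #|nonmult A2 q|) ->
  3 * m0 + (U + U) + w <= #|A2| ->
  exists a, forall j, j < w * m0 -> ssum A2 (2 + (U + U) + w) (a + j).
Proof.
move=> AN N2 hi1 mk hbig hnm hA.
have d0 (B : {set 'I_n.+1}) : [disjoint set0 & B] by rewrite -setI_eq0 set0I.
have e0 e : e \in [:: 0%R : int] -> exists2 u, e = Posz u & ssum (set0 : {set 'I_n.+1}) 1 u.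
  by rewrite inE => /eqP->; exists 0 => //; exists set0; rewrite sub0set cards0 big_set0.
have r0 e : e \in [:: 0%R : int] -> (0 <= e <= Posz N)%R by rewrite inE => /eqP->.
have m2 : m0 <= 2 * (2 ^ k * size [:: 0%R : int]) by rewrite muln1 (leq_trans mk) // leq_pmull.
have rob : robust A2 (U + U) m0 N.
  by apply: robust_intro => //; move: hA; move: (U + U) #|A2|; clear; lia.
apply: (@interval_of_pool _ A2 A2 set0 set0 [:: 0%R] [:: 0%R] m0 N i1 k w rob) => //;
  by rewrite ?sub0set ?cards0.
Qed.

Lemma leq_card_bigcup (I T : finType) (B : I -> {set T}) c :
  (forall i, #|B i| <= c) -> #|\bigcup_i B i| <= #|I| * c.
Proof.
move=> hB; rewrite -sum_nat_const.
apply: (big_ind2 (fun (S : {set T}) k => #|S| <= k)) => //; first by rewrite cards0.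
by move=> S1 k1 S2 k2 h1 h2; rewrite (leq_trans (leq_card_setU _ _)) ?leq_add.
Qed.

Lemma dense_interval n (A2 : {set 'I_n.+1}) m0 N i1 w (U := steps 0 i1) :
  (forall x, x \in A2 -> 0 < x <= N) -> 2 < N -> 0 < m0 -> N < i1 * m0 ->
  U + U < #|[set x in A2 | N <= 2 * x]| ->
  (forall q, 1 < q -> U + U < #|nonmult A2 q|) ->
  3 * m0 + (U + U) + w < #|A2| -> i1.+2 * (U + U).+1 + 2 * m0 <= #|A2| ->
  exists a, forall j, j < w * m0 -> ssum A2 (2 + (U + U) + w) (a + j).
Proof.
move=> AN N2 m00 hi1 hbig hnm hA hR.
have [Bb sBb cBb] := exists_subset_card hbig.
have [B hB] : exists B : 'I_i1.+1 -> {set 'I_n.+1}, forall q : 'I_i1.+1,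
    #|B q| <= (U + U).+1 /\ (1 < q -> B q \subset nonmult A2 q /\ #|B q| = (U + U).+1).
  apply: (@fin_all_exists _ (fun=> {set 'I_n.+1})
    (fun (q : 'I_i1.+1) (S : {set 'I_n.+1}) =>
    #|S| <= (U + U).+1 /\ (1 < q -> S \subset nonmult A2 q /\ #|S| = (U + U).+1))) => q.
  have [q1|q1] := leqP q 1; first by exists set0; rewrite cards0.
  by have [S sS cS] := exists_subset_card (hnm _ q1); exists S; rewrite cS leqnn.
(* Reserving [R] for the pool keeps it robust after the blocks [E1] and [E2] are taken out;
   moduli above [i1] need no reserve, having at most [m0] multiples up to [N]. *)
pose R := Bb :|: \bigcup_q B q.
have cR : #|R| <= i1.+2 * (U + U).+1.
  rewrite mulSn (leq_trans (leq_card_setU _ _)) // cBb leq_add2l.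
  by rewrite -[X in _ <= X * _]card_ord; apply: leq_card_bigcup => q; case: (hB q).
have hAR : 2 * m0 <= #|A2 :\: R|.
  have := cardsID R A2; have : #|A2 :&: R| <= #|R| by apply/subset_leq_card/subsetIr.
  move: #|A2 :\: R| #|A2 :&: R| #|R| #|A2| cR hR; clear; lia.
have [E1 sE1 cE1] : exists2 E1 : {set 'I_n.+1}, E1 \subset A2 :\: R & #|E1| = m0.
  by apply: exists_subset_card; lia.
have [E2 sE2 cE2] : exists2 E2 : {set 'I_n.+1}, E2 \subset (A2 :\: R) :\: E1 & #|E2| = m0.
  by apply: exists_subset_card; rewrite [in X in _ <= X]cardsD (setIidPr sE1) cE1; lia.
have sE1A := subset_trans sE1 (subsetDl _ _).
have sE2' := subset_trans sE2 (subsetDl _ _).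
have sE2A := subset_trans sE2' (subsetDl _ _).
have dE : [disjoint E1 & E2] by move: sE2; rewrite subsetD disjoint_sym => /andP[].
pose P := A2 :\: (E1 :|: E2).
have sE : E1 :|: E2 \subset A2 by rewrite subUset sE1A.
have cP : #|P| = #|A2| - 2 * m0.
  by rewrite cardsD (setIidPr sE) cardsU disjoint_setI0 // cards0 cE1 cE2; lia.
have PN x : x \in P -> 0 < x <= N by rewrite inE => /andP[_ /AN].
have keep (S T : {set 'I_n.+1}) : S \subset T -> T \subset A2 -> S \subset R -> S \subset T :&: P.
  move=> sST sTA sSR; rewrite subsetI sST subsetD (subset_trans sST) //=.
  rewrite disjoints_subset; apply/subsetP => x xS; rewrite !inE negb_or.
  have xR := subsetP sSR _ xS.
  apply/andP; split; apply/negP.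
    by move/(subsetP sE1); rewrite inE xR.
  by move/(subsetP sE2'); rewrite inE xR.
have seqE (E : {set 'I_n.+1}) : E \subset A2 -> #|E| = m0 ->
   [/\ uniq [seq Posz x | x : 'I_n.+1 in E], size [seq Posz x | x : 'I_n.+1 in E] = m0,
    (forall e, e \in [seq Posz x | x : 'I_n.+1 in E] -> exists2 u, e = Posz u & ssum E 1 u) &
    (forall e, e \in [seq Posz x | x : 'I_n.+1 in E] -> 0 <= e <= Posz N)%R].
  move=> sEA cE; split.
  - by rewrite map_inj_uniq ?enum_uniq // => x y [/val_inj].
  - by rewrite size_map -cardE.
  - move=> e /mapP[x]; rewrite mem_enum => xE ->; exists (x : nat) => //.
    by exists [set x]; rewrite sub1set cards1 big_set1.
  - by move=> e /mapP[x]; rewrite mem_enum => /(subsetP sEA)/AN h ->; lia.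
have [u1 z1 e1 r1] := seqE _ sE1A cE1.
have [u2 z2 e2 r2] := seqE _ sE2A cE2.
have dP1 : [disjoint E1 & P].
  by rewrite disjoints_subset; apply/subsetP => x xE; rewrite !inE xE.
have dP2 : [disjoint E2 & P].
  by rewrite disjoints_subset; apply/subsetP => x xE; rewrite !inE xE orbT.
have rob : robust P (U + U) m0 N.
  apply: robust_intro.
  - by rewrite cP; move: hA; move: #|A2| (U + U); clear; lia.
  - rewrite -cBb; apply: subset_leq_card.
    have -> : [set x in P | N <= 2 * x] = [set x in A2 | N <= 2 * x] :&: P.
      by apply/setP => x; rewrite !inE; case: (x \in A2) => //=; rewrite ?andbF ?andbT // andbC.
    apply: keep => //; last exact: subsetUl.
    by apply/subsetP => x; rewrite inE => /andP[].
  move=> q q1; have [qi|iq] := ltnP q i1.+1.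
    have [_ /(_ q1)[sB cB]] := hB (Ordinal qi).
    rewrite -cB; apply: subset_leq_card.
    have -> : nonmult P q = nonmult A2 q :&: P.
      by apply/setP => x; rewrite !inE; case: (x \in A2) => //=; rewrite ?andbF ?andbT // andbC.
    apply: keep => //; first by apply/subsetP => x; rewrite inE => /andP[].
    by apply: subset_trans (subsetUr _ _); apply: (bigcup_sup (Ordinal qi)).
  have hq := @card_nonmult_ge _ P N q (ltnW q1) PN.
  have hm : N %/ q <= m0.
    have : N < m0.+1 * q.
      by apply: leq_trans hi1 _; rewrite mulnC leq_mul // ltnW.
    by rewrite -ltn_divLR ?(ltnW q1).
  move: hq hm hA; rewrite cP; move: #|nonmult P q| #|A2| (U + U) (N %/ q); clear; lia.
have mm (s : seq int) : size s = m0 -> m0 <= 2 * (2 ^ 0 * size s).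
  by move=> ->; rewrite mul1n leq_pmull.
by apply: (interval_of_pool rob AN N2 (ltnW hi1) (subsetDl _ _) sE1A sE2A _ _ dP1 dP2 dE
  u1 u2 e1 e2 r1 r2 (mm _ z1) (mm _ z2) (ltnW hA)); rewrite ?cE1 ?cE2.
Qed.

(** * Choosing the range and the divisor *)

Lemma exists_trim n (A1 : {set 'I_n.+1}) n1 m0 a b :
  (forall x, x \in A1 -> x <= n1) ->
  let f N := a * (n1 %/ m0 - N %/ m0) + b * (trunc_log 2 n1 - trunc_log 2 N) in
  exists N, [/\ N <= n1, #|[set x in A1 | N < x]| <= f N &
    0 < N -> f (N %/ 2) < #|[set x in A1 | N %/ 2 < x]|].
Proof.
move=> An1 f; have exN : exists N, #|[set x in A1 | N < x]| <= f N.
  exists n1; rewrite (_ : [set x in A1 | n1 < x] = set0) ?cards0 //.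
  by apply/setP => x; rewrite !inE ltnNge; apply/negP => /andP[/An1 ->].
case: (ex_minnP exN) => N hN Nmin; exists N; split=> //.
  apply: Nmin; rewrite (_ : [set x in A1 | n1 < x] = set0) ?cards0 //.
  by apply/setP => x; rewrite !inE ltnNge; apply/negP => /andP[/An1 ->].
move=> N0; rewrite ltnNge; apply/negP => /Nmin; lia.
Qed.

Lemma trunc_log2_half N : 1 < N -> trunc_log 2 (N %/ 2) < trunc_log 2 N.
Proof.
move=> N1; have N20 : 0 < N %/ 2 by lia.
rewrite -(@trunc_logMp 2) //; apply: leq_trunc_log; lia.
Qed.

(** Minimality of [N] fails the threshold at [N / 2], so at least [f (N / 2) - f N] elements lie in
    the upper half. This difference is at least [a (N / m0) / 2 + b], as halving lowers the
    logarithm by at least one. *)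
Lemma trim_pool n (A1 : {set 'I_n.+1}) n1 m0 a b :
  (forall x, x \in A1 -> 0 < x <= n1) ->
  a * (n1 %/ m0) + b * trunc_log 2 n1 + 2 <= #|A1| ->
  exists (A2 : {set 'I_n.+1}) N, [/\ A2 \subset A1, N <= n1,
    (forall x, x \in A2 -> 0 < x <= N) &
    [/\ #|A1| <= #|A2| + (a * (n1 %/ m0) + b * trunc_log 2 n1),
     (a * (N %/ m0) + 2 * b <= 2 * #|[set x in A2 | N <= 2 * x]|) &
     forall q, #|nonmult A1 q| <= #|nonmult A2 q| + (a * (n1 %/ m0) + b * trunc_log 2 n1)]].
Proof.
move=> An1 hA1.
have [|N [Nn1 hN hN2]] := @exists_trim n A1 n1 m0 a b; first by move=> x /An1/andP[].
pose Ab := [set x in A1 | N < x]; pose A2 := [set x in A1 | x <= N].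
have cb : #|Ab| <= a * (n1 %/ m0) + b * trunc_log 2 n1.
  by apply: leq_trans hN _; rewrite leq_add // leq_mul2l leq_subr orbT.
have sub (S T : {set 'I_n.+1}) : S \subset A1 -> (forall x, x \in S -> x <= N -> x \in T) ->
    #|S| <= #|T| + #|Ab|.
  move=> sS hS; apply: leq_trans (leq_card_setU T Ab); apply: subset_leq_card.
  apply/subsetP => x xS; rewrite !inE (subsetP sS _ xS) /=.
  by case: (leqP x N) => [/(hS _ xS)->//|]; rewrite orbT.
have A2N x : x \in A2 -> 0 < x <= N by rewrite inE => /andP[/An1/andP[-> _] ->].
have cA2 : #|A1| <= #|A2| + #|Ab| by apply: sub => // x xA xN; rewrite inE xA.
have N1 : 1 < N.
  have := card_le_bound A2N; move: cA2 cb hA1.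
  by move: #|A1| #|A2| #|Ab| (a * _ + _); clear; lia.
exists A2, N; split=> //; first by apply/subsetP => x; rewrite inE => /andP[].
split; first exact: leq_trans cA2 (leq_add _ cb).
- have := hN2 (ltnW N1); set S := [set x in A1 | N %/ 2 < x] => h1.
  have h2 : #|S| <= #|[set x in A2 | N <= 2 * x]| + #|Ab|.
    apply: sub; first by apply/subsetP => x; rewrite inE => /andP[].
    by move=> x; rewrite !inE => /andP[-> /= h] ->; lia.
  rewrite -/Ab in hN; move: h1 h2 hN.
  have t1 := trunc_log2_half N1; have t2 := leq_trunc_log 2 Nn1.
  have -> : (N %/ 2) %/ m0 = (N %/ m0) %/ 2 by rewrite -!divnMA mulnC.
  have := leq_div2r m0 Nn1; have := @leq_divM (N %/ m0) 2; rewrite -?/(_ %/ _).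
  move: (N %/ m0) (n1 %/ m0) => y Y.
  move: #|Ab| #|S| #|_| => u v z.
  move: (trunc_log 2 N) (trunc_log 2 (N %/ 2)) (trunc_log 2 n1) t1 t2.
  move=> t t' T t1 t2 hy yY h1 h2 h3.
  have g1 : a * (Y - y) + a * (y - y %/ 2) <= a * (Y - y %/ 2) by rewrite -mulnDr leq_mul2l; lia.
  have g2 : b * (T - t) + b <= b * (T - t') by rewrite -mulnSr leq_mul2l; lia.
  have g3 : a * y <= 2 * (a * (y - y %/ 2)) by rewrite mulnCA leq_mul2l; lia.
  by move: (a * (Y - y)) (a * (Y - y %/ 2)) (a * (y - y %/ 2)) (a * y)
    (b * (T - t)) (b * (T - t')) g1 g2 g3 h1 h2 h3; clear; lia.
move=> q; apply: leq_trans (leq_add (leqnn _) cb); apply: sub.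
  by apply/subsetP => x; rewrite inE => /andP[].
by move=> x; rewrite !inE => /andP[-> ->] ->.
Qed.

Lemma robust_interval n (A1 : {set 'I_n.+1}) n1 m kd kap L :
  (forall x, x \in A1 -> 0 < x <= n1) -> trunc_log 2 n1 < L -> n1 < m * kd.+1 ->
  kd <= kap -> 0 < kap -> 63 * m <= 64 * #|A1| ->
  1024 * (1024 * (1024 * (1024 * kap))) <= m ->
  1024 * (1024 * (1024 * (1024 * (L * L * L)))) <= m ->
  (forall q, 1 < q -> 32 * (1024 * (1024 * (kd + L * L))) <= #|nonmult A1 q|) ->
  exists a, forall j, j < 5 * kap * (m %/ 4) -> ssum A1 (32 * (1024 * (1024 * kap))) (a + j).
Proof.
move=> An1 tL n1m kdk k0 cA1 mk mL hq.
have L0 : 0 < L by lia.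
have L1 : L <= L * L by rewrite leq_pmull.
have L2 : L * L <= L * L * L by rewrite leq_pmulr.
have [m0 m0E] : exists m0, m0 = m %/ 4 by exists (m %/ 4).
have m04 : 4 * m0 <= m <= 4 * m0 + 3 by lia.
have m03 : 1000 < m0 by lia.
have Yk : n1 %/ m0 <= 5 * kd.+1.
  rewrite -ltnS ltn_divLR; last lia.
  apply: leq_trans n1m _; rewrite mulnC.
  by apply: (@leq_trans (kd.+1 * (5 * m0))); [rewrite leq_mul2l; lia | lia].
(* With [y = N / m0], the weights [a] and [64 L] make [a y / 2 + 64 L] exceed [2 steps L (y + 1)]
   once [y >= 3]. *)
pose a := 2 * (1024 * 1024).
have [D DE] : exists D, D = a * (n1 %/ m0) + 64 * L * trunc_log 2 n1 by eexists.
have D1 : D <= a * (5 * kd.+1) + 64 * (L * L).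
  rewrite DE leq_add //; first by rewrite leq_mul2l Yk orbT.
  by rewrite -mulnA leq_mul2l leq_mul2l (ltnW tL) !orbT.
rewrite /a in D1.
have D2 : 128 * D <= m by lia.
have DA : a * (n1 %/ m0) + 64 * L * trunc_log 2 n1 + 2 <= #|A1| by rewrite -DE; lia.
have [A2 [N [sA2 Nn1 A2N [cA2 big nm]]]] := trim_pool An1 DA.
rewrite -DE in cA2 nm.
have NA := card_le_bound A2N.
have [y yE] : exists y, y = N %/ m0 by exists (N %/ m0).
rewrite -yE /a in big.
(* [A2] keeps more than three quarters of [m] elements, all between 1 and [N]. *)
have y3 : 3 <= y by rewrite yE leq_divRL; lia.
have Ny : N < y.+1 * m0 by rewrite yE ltn_ceil; lia.
have yk : y <= 5 * kd.+1 by apply: leq_trans Yk; rewrite yE leq_div2r.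
have sE k : steps k y.+1 + steps k y.+1 = 24 + 48 * k + 540 * (1024 * y.+1) by rewrite /steps; lia.
have hbig : steps L y.+1 + steps L y.+1 < #|[set x in A2 | N <= 2 * x]|.
  by rewrite sE; move: #|_| big => B big; lia.
have hnm q : 1 < q -> steps L y.+1 + steps L y.+1 < #|nonmult A2 q|.
  move=> q1; have := hq _ q1; have := nm q; rewrite sE.
  by move: #|nonmult A1 q| #|nonmult A2 q| => u v; lia.
(* If [L <= kap], the budget pays for about [2 L] start-up steps. Otherwise the reserve of the dense
   case has order [L^2], far below [m], and start-up is avoided. *)
have [Lk|kL] := leqP L kap.
  have [|||a0 ha0] := @sparse_interval _ A2 m0 N y.+1 L (5 * kap) A2N _ (ltnW Ny) _ hbig hnm.
  - lia.
  - apply: leq_trans (_ : n1 <= _); first lia.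
    apply: (@leq_trans (2 ^ (trunc_log 2 n1).+1)); first exact/ltnW/trunc_log_ltn.
    by rewrite leq_exp2l.
  - by rewrite sE; lia.
  exists a0 => j; rewrite -m0E => /ha0; apply: ssumW => //.
  by rewrite sE; lia.
have sle : steps 0 y.+1 + steps 0 y.+1 <= steps L y.+1 + steps L y.+1 by rewrite !sE; lia.
have [||||a0 ha0] := @dense_interval _ A2 m0 N y.+1 (5 * kap) A2N _ _ Ny
   (leq_ltn_trans sle hbig) (fun q q1 => leq_ltn_trans sle (hnm q q1)).
- lia.
- lia.
- by rewrite sE; lia.
- rewrite sE; have h1 : y.+3 <= 13 * L by lia.
  have h2 : (24 + 48 * 0 + 540 * (1024 * y.+1)).+1 <= 8 * (1024 * (1024 * L)) by lia.
  have := leq_mul h1 h2; move: (y.+3 * _); lia.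
exists a0 => j; rewrite -m0E => /ha0; apply: ssumW => //.
by rewrite sE; lia.
Qed.

(** [d = 1] meets the threshold, and the largest [d] that does is taken. As
    [f d <= c (2 kap + L^2 log n)], few elements are lost. *)
Lemma exists_divisor n (A : {set 'I_n.+1}) kap L c : 0 < n ->
  let f d := c * (2 * (kap - kap %/ d) + L * L * trunc_log 2 d) in
  exists d, [/\ 0 < d <= n, #|nonmult A d| <= f d &
    forall q, 1 < q -> d * q <= n -> f (d * q) < #|nonmult A (d * q)|].
Proof.
move=> n0 f; pose p d := (0 < d <= n) && (#|nonmult A d| <= f d).
have exd : exists d, p d.
  exists 1; rewrite /p n0 /= (_ : nonmult A 1 = set0) ?cards0 //.
  by apply/setP => x; rewrite !inE dvd1n andbF.
have pn d : p d -> d <= n by case/andP => /andP[].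
case: (ex_maxnP exd pn) => d /andP[/andP[d0 dn] hd] dmax; exists d; rewrite d0 dn.
split=> // q q1 dqn; rewrite ltnNge; apply/negP => hdq.
have : p (d * q) by rewrite /p dqn hdq muln_gt0 d0 (ltnW q1).
move/dmax; rewrite leqNgt => /negP; apply; exact: ltn_Pmulr.
Qed.

(** Passing to [d q] at least halves [kap / d] and raises the logarithm by at least one. The
    increase is the number of non-multiples that [robust_interval] asks for after division by
    [d]. *)
Lemma threshold_step kap L c d q : 0 < d -> 1 < q ->
  c * (2 * (kap - kap %/ d) + L * L * trunc_log 2 d) + c * (kap %/ d + L * L)
  <= c * (2 * (kap - kap %/ (d * q)) + L * L * trunc_log 2 (d * q)).
Proof.
move=> d0 q1; rewrite -mulnDr leq_mul2l; apply/orP; right.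
have h1 : (trunc_log 2 d).+1 <= trunc_log 2 (d * q).
  by rewrite -(@trunc_logMp 2) // leq_trunc_log // mulnC leq_mul2l q1 orbT.
have h2 : L * L * (trunc_log 2 d).+1 <= L * L * trunc_log 2 (d * q) by rewrite leq_mul2l h1 orbT.
have h3 : kap %/ (d * q) <= kap %/ d %/ 2 by rewrite divnMA leq_div2l.
have h4 := leq_div kap d.
rewrite mulnS in h2; move: (L * L) (L * L * _) (L * L * _) h2 h3 h4 => l u v.
move: (kap %/ d) (kap %/ (d * q)) => w z; lia.
Qed.

Lemma card_le_div_set n (A B C : {set 'I_n.+1}) d : 0 < d ->
  B \subset A -> (forall x, x \in B -> d %| x) ->
  (forall x y : 'I_n.+1, x \in B -> y = x %/ d :> nat -> y \in div_set d A -> y \in C) ->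
  #|B| <= #|C|.
Proof.
move=> d0 sB dB BC.
have val (x : 'I_n.+1) : (inord (x %/ d) : 'I_n.+1) = x %/ d :> nat.
  by rewrite inordK // ltnS (leq_trans (leq_div _ _)) // -ltnS.
pose f (x : 'I_n.+1) : 'I_n.+1 := inord (x %/ d).
rewrite -(card_in_imset (f := f)).
  apply: subset_leq_card; apply/subsetP => y /imsetP[x xB ->].
  apply: (BC x) => //; rewrite ?val // inE; apply/existsP; exists x.
  by rewrite (subsetP sB _ xB) dB // val eqxx.
move=> x y xB yB /(congr1 (@nat_of_ord _)); rewrite !val => e; apply/val_inj.
by rewrite /= -(divnK (dB _ xB)) -(divnK (dB _ yB)) e.
Qed.

Lemma div_set_interval n (A : {set 'I_n.+1}) m kap L : subset_of_range A ->
  0 < n -> m = #|A| -> kap = (n %/ m).+1 -> L = (trunc_log 2 n).+1 ->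
  1024 * (1024 * (1024 * (1024 * kap))) <= m ->
  1024 * (1024 * (1024 * (1024 * (L * L * L)))) <= m ->
  exists2 d, 0 < d &
  (exists a, forall j, j < n -> ssum (div_set d A) (32 * (1024 * (1024 * kap))) (a + j)) /\
  #|A| <= #|div_set d A| + 32 * (1024 * (1024 * (2 * kap + L * L * trunc_log 2 n))).
Proof.
move=> A0 n0 mE kE LE mk mL.
have [c cE] : exists c, forall x, c * x = 32 * (1024 * (1024 * x)).
  by exists (32 * (1024 * 1024)) => x; rewrite -!mulnA.
have [d [/andP[d0 dn] hd hdq]] := exists_divisor A kap L c n0.
have tn : trunc_log 2 d <= trunc_log 2 n by rewrite leq_trunc_log.
set A1 := div_set d A.
have hd' : #|nonmult A d| <= 32 * (1024 * (1024 * (2 * kap + L * L * trunc_log 2 n))).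
  apply: leq_trans hd _; rewrite -cE leq_mul2l leq_add ?orbT //.
    by rewrite leq_mul2l leq_subr.
  by rewrite !leq_mul2l tn !orbT.
have hL : L * L * trunc_log 2 n <= L * L * L by rewrite leq_mul2l LE leqnSn orbT.
pose Ad := [set x in A | d %| x].
have cAd : #|A| = #|nonmult A d| + #|Ad|.
  rewrite -(cardsID (nonmult A d) A); congr (_ + _); apply: eq_card => x; rewrite !inE.
    by case: (x \in A).
  by case: (x \in A); rewrite /= ?andbF ?negbK ?andbT.
have cA1 : #|Ad| <= #|A1|.
  apply: (@card_le_div_set _ A _ _ d) => //; first by apply/subsetP => x; rewrite inE => /andP[].
  by move=> x; rewrite inE => /andP[].
have A1P y : y \in A1 -> exists2 x, x \in A & d * y = x :> nat.
  rewrite inE => /existsP[x /andP[xA /andP[dx /eqP <-]]]; exists x => //.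
  by rewrite mulnC divnK.
have nmk : n < m * kap by rewrite kE mulnC ltn_ceil //; lia.
exists d => //; split; last by rewrite cAd addnC leq_add.
have [|||||||||a ha] := @robust_interval _ A1 (n %/ d) m (kap %/ d) kap L.
- move=> y /A1P[x xA xy]; have := A0 _ xA; rewrite -xy muln_gt0 => /andP[_ ->] /=.
  by rewrite leq_divRL // mulnC xy -ltnS.
- by rewrite LE ltnS leq_trunc_log // leq_div.
- rewrite ltn_divLR // (leq_trans nmk) // -mulnA leq_mul2l; apply/orP; right.
  by apply: ltnW; rewrite ltn_ceil.
- exact: leq_div.
- by rewrite kE.
- by rewrite mE in mk mL *; lia.
- exact: mk.
- exact: mL.
- move=> q q1.
  (* A non-multiple of [d q] is either a non-multiple of [d] or [d] times a non-multiple of [q]. *)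
  have B1 : #|nonmult A (d * q)| <= #|nonmult A d| + #|nonmult A1 q|.
    rewrite -(cardsID (nonmult A d) (nonmult A (d * q))) leq_add //.
      by apply: subset_leq_card; apply: subsetIr.
    apply: (@card_le_div_set _ A _ _ d) => //.
    + by apply/subsetP => x; rewrite !inE => /andP[_ /andP[]].
    + by move=> x; rewrite !inE => /andP[h /andP[xA _]]; rewrite xA /= negbK in h.
    move=> x y; rewrite !inE => /andP[dx /andP[xA ndq]] yE ->; rewrite xA /= negbK in dx.
    by apply: contra ndq => qy; rewrite -(divnK dx) -yE [d * q]mulnC dvdn_pmul2r.
  have [dqn|ndq] := leqP (d * q) n.
    have := hdq _ q1 dqn; have := threshold_step kap L c d0 q1.
    rewrite -cE; move: B1 hd; move: #|_| #|_| #|_| => u v w.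
    move: (c * _) (c * _) (c * _) => x y z; clear; lia.
  have e : nonmult A (d * q) = A.
    apply/setP => x; rewrite inE; case xA: (x \in A) => //=.
    apply/negP => /dvdn_leq; rewrite A0 // => /(_ isT).
    by rewrite leqNgt (leq_trans (ltn_ord x)).
  rewrite e -mE in B1; have kk := leq_div kap d.
  have L1 : L * L <= L * L * L by rewrite leq_pmulr // LE.
  lia.
exists a => j jn; apply: ha; apply: leq_trans jn _.
(* The 5 in the length absorbs the rounding of [m / 4]; then [n < m kap] finishes. *)
have : m <= 5 * (m %/ 4) by lia.
move=> h; have : m * kap <= 5 * (m %/ 4) * kap by rewrite leq_mul2r h orbT.
lia.
Qed.

Lemma cube_log_le_sqrt n : 0 < n -> let L := (trunc_log 2 n).+1 in
  exists2 s, s * s <= n & L * L * L <= 6 * (6 * (6 * s)).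
Proof.
(* With [u = 2^(t/6)] the witness is [u^3]: its square is at most [2^t], while
   [L <= 6 (t/6 + 1) <= 6 u]. *)
move=> n0 L; set t := trunc_log 2 n; exists (2 ^ (3 * (t %/ 6))).
  rewrite -expnD; have := trunc_logP (isT : 1 < 2) n0; apply: leq_trans.
  by rewrite -/t leq_exp2l //; lia.
have h : L <= 6 * 2 ^ (t %/ 6).
  have := ltn_expl (t %/ 6) (isT : 1 < 2); rewrite /L -/t; lia.
have := leq_mul (leq_mul h h) h; rewrite mulnC expnM -!mulnA.
rewrite -[(2 ^ 3) ^ _]expnM [3 * _]mulnC expnM.
by move: (2 ^ _) => u; lia.
Qed.

Lemma large_of_square n m : 0 < n -> 0 < m ->
  iter 12 (muln 1024) n <= m * m ->
  let kap := (n %/ m).+1 in let L := (trunc_log 2 n).+1 in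
  1024 * (1024 * (1024 * (1024 * kap))) <= m /\
  1024 * (1024 * (1024 * (1024 * (L * L * L)))) <= m.
Proof.
move=> n0 m0 /= h.
have sq s : s * s <= n -> 1024 * (1024 * (1024 * (1024 * (1024 * (1024 * s))))) <= m.
  move=> sn; rewrite leqNgt; apply/negP => lt.
  have := ltn_mul lt lt; lia.
have [s s1 s2] := cube_log_le_sqrt n0.
have h1 := sq 1 n0; have h2 := sq _ s1; split; last lia.
have h3 := leq_divM n m; set k := n %/ m in h3 *.
have : 1024 * (1024 * (1024 * (1024 * (1024 * k)))) <= m; last lia.
rewrite -(leq_pmul2r m0); lia.
Qed.

(* Imported only here: [%R] now delimits [R_scope] and no longer [ring_scope]. *)
From Stdlib Require Import Reals Lra.

(** * Passage to real numbers *)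

Lemma INR_leq (a b : nat) : a <= b -> (INR a <= INR b)%R.
Proof. by move/ssrnat.leP; exact: le_INR. Qed.

Lemma INR_muln (a b : nat) : INR (muln a b) = (INR a * INR b)%R.
Proof. exact: mult_INR. Qed.

Lemma INR_addn (a b : nat) : INR (addn a b) = (INR a + INR b)%R.
Proof. exact: plus_INR. Qed.

Lemma INR_expn2 (k : nat) : INR (expn 2 k) = (2 ^ k)%R.
Proof.
by elim: k => [|k IH]; [rewrite expn0 | rewrite expnS INR_muln IH -tech_pow_Rmult].
Qed.

Lemma INR_trunc_log (n : nat) : 0 < n -> (INR (trunc_log 2 n) <= 2 * ln (INR n))%R.
Proof.
move=> n0; have := INR_leq (trunc_logP (isT : 1 < 2) n0); rewrite INR_expn2 => h.
have p2 : (0 < 2 ^ trunc_log 2 n)%R by apply: pow_lt; lra.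
have : (ln (2 ^ trunc_log 2 n) <= ln (INR n))%R.
  by case: h => [h|->]; [left; apply: ln_increasing | right].
rewrite ln_pow; last lra.
have := ln_lt_2; have := pos_INR (trunc_log 2 n).
move: (INR _) (ln 2) => t l; nra.
Qed.

Theorem theorem6p1 :
  exists C : R, (0 < C)%R /\
  forall (n : nat) (A : {set 'I_n.+1}),
    subset_of_range A ->
    (C * sqrt (INR n) <= INR #|A|)%R ->
    exists d : nat, (1 <= d)%N /\
      let A' := div_set d A in
      let k : R := (2 ^ 50 * INR n / INR #|A|)%R in
      (exists a : nat, forall j : nat, (j < n)%N -> in_subset_sums k A' (a + j)) /\
      (INR #|A| - INR #|A'| <= 2 ^ 30 * (ln (INR n)) ^ 3 + 2 ^ 30 * INR n / INR #|A|)%R.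
Proof.
have I1024 : INR 1024 = 1024%R by rewrite INR_IZR_INZ.
have I32 : INR 32 = 32%R by rewrite INR_IZR_INZ.
have I2 : INR 2 = 2%R by rewrite INR_IZR_INZ.
exists (1024 ^ 6)%R; split; first by apply: pow_lt; lra.
move=> n A A0 hA; set m := #|A| in hA *.
have An x : x \in A -> 0 < x <= n by move=> xA; rewrite A0 //= -ltnS.
have mn : m <= n := card_le_bound An.
have [n0|n0] := posnP n.
  have m0 : m = 0 by lia.
  have nR : INR n = 0%R by rewrite n0.
  have mR : INR m = 0%R by rewrite m0.
  exists 1; split=> //; split; first by exists 0 => j jn; exfalso; lia.
  (* For [n = 0] the logarithm takes its default value 0, and the quotient has numerator 0. *)
  rewrite nR mR /ln; case: Rlt_dec => [h|_]; first by case: (Rlt_irrefl 0).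
  by have := pos_INR #|div_set 1 A|; rewrite /Rdiv; lra.
have n1 : (1 <= INR n)%R by have := INR_leq n0.
have sq1 : (0 < sqrt (INR n))%R by apply: sqrt_lt_R0; lra.
have C0 : (0 < 1024 ^ 6)%R by apply: pow_lt; lra.
have mpos : (0 < INR m)%R by apply: Rlt_le_trans hA; apply: Rmult_lt_0_compat.
have m0 : 0 < m by rewrite lt0n; apply/eqP => e; move: mpos; rewrite e /=; lra.
have hsq : iter 12 (muln 1024) n <= m * m.
  apply/ssrnat.leP; apply: INR_le; rewrite [iter _ _ _]/= !INR_muln I1024.
  have h := sqrt_sqrt (INR n) ltac:(lra).
  have : ((1024 ^ 6 * sqrt (INR n)) * (1024 ^ 6 * sqrt (INR n)) <= INR m * INR m)%R.
    by apply: Rmult_le_compat => //; apply: Rmult_le_pos; lra.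
  by lra.
have [mk mL] := large_of_square n0 m0 hsq.
have [d d0 [[a ha] hd]] := div_set_interval A0 n0 (erefl m) erefl erefl mk mL.
set kap := (n %/ m).+1 in mk ha hd; set t := trunc_log 2 n in mL hd.
have kapR : (INR kap <= 2 * (INR n / INR m))%R.
  have : kap * m <= 2 * n by rewrite /kap mulSn; have := leq_divM n m; lia.
  move/INR_leq; rewrite !INR_muln I2 => h.
  apply: (Rmult_le_reg_r (INR m)) => //.
  have -> : (2 * (INR n / INR m) * INR m = 2 * INR n)%R by field; lra.
  exact: h.
have q0 : (0 <= INR n / INR m)%R.
  by apply: Rmult_le_pos; [lra | left; apply: Rinv_0_lt_compat].
exists d; split=> //; split.
  exists a => j jn; have [F [sF cF sumF]] := ha j jn.
  exists F; split=> //; split=> //.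
  (* The count is at most [2^25 kap <= 2^26 n / m], well within [2^50 n / m]. *)
  apply: Rle_trans (INR_leq cF) _; rewrite !INR_muln I32 I1024.
  by rewrite /Rdiv Rmult_assoc -/(Rdiv _ _); lra.
have t1 : 0 < t by rewrite trunc_log_gt0; lia.
have := INR_leq hd; rewrite -/m !(INR_addn, INR_muln) I32 I1024 I2 => h.
have hL : (INR t.+1 <= 2 * INR t)%R.
  by rewrite S_INR; have := INR_leq t1; rewrite [INR 1]/=; lra.
have ht := INR_trunc_log n0; rewrite -/t in ht.
have t0 := pos_INR t; have L0 := pos_INR t.+1.
(* From [t <= 2 ln n] and [t + 1 <= 4 ln n]; the product of 32 and [2^25] is the constant [2^30]. *)
have hl : (INR t.+1 * INR t.+1 * INR t <= 32 * ln (INR n) ^ 3)%R.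
  have h1 : (INR t.+1 * INR t.+1 <= (4 * ln (INR n)) * (4 * ln (INR n)))%R.
    by apply: Rmult_le_compat; lra.
  have : (INR t.+1 * INR t.+1 * INR t
          <= (4 * ln (INR n)) * (4 * ln (INR n)) * (2 * ln (INR n)))%R.
    by apply: Rmult_le_compat => //; apply: Rmult_le_pos.
  by lra.
have -> : (2 ^ 30 * INR n / INR m = 2 ^ 30 * (INR n / INR m))%R by rewrite /Rdiv Rmult_assoc.
by rewrite -/m; lra.
Qed.
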